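(* Let $T>0$. There exists a constant $C=C(T)>0$ such that for every positive integer $n$, with $h=\sqrt{T/n}$, $$\int_{-\infty}^\infty\big|\mathbb{E}\big[B^{0,T,-x}_{\mathcal{T}(x)}\big]\big|\,p_T(0,x)\,dx\le C\,h^2,$$ where $\mathcal{T}(x):=\mathcal{T}_{(kh-x,\,(k+1)h-x)}$ if $x\in(kh,(k+1)h)$, $k\in\mathbb{Z}$.
   Context: $(B^{0,T,y}_t)_{0\le t\le T}$ is the Brownian bridge from $0$ to $y$ of length $T$, i.e. standard Brownian motion started at $0$ conditioned to be at $y$ at time $T$ (a continuous Gaussian process with mean $yt/T$ and covariance $s\wedge t-st/T$). $\mathcal{T}_{(a,b)}$ is the first exit time of the process under consideration (here the bridge $B^{0,T,-x}$) from $(a,b)$, i.e. $\mathcal{T}_{(a,b)}:=\inf\{t>0:B^{0,T,-x}_t\notin(a,b)\}$. $p_T(0,x)=\frac{1}{\sqrt{2\pi T}}e^{-x^2/(2T)}$. The integrand is defined for all $x\notin h\mathbb{Z}$, i.e. Lebesgue almost everywhere. *)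

(* Defs.v *)
From mathcomp Require Import all_boot all_order all_algebra.
From mathcomp Require Import all_classical all_reals all_analysis.

Set Implicit Arguments.
Unset Strict Implicit.
Unset Printing Implicit Defensive.

Import Order.TTheory GRing.Theory Num.Theory.
Import numFieldNormedType.Exports.

Local Open Scope classical_set_scope.
Local Open Scope ring_scope.

(* The variance-zero case needs the Dirac mass: [normal_prob m 0] is, by the
   library's convention, the uniform law on [0, 1]. *)
Definition gaussian_law (R : realType) (m s : R) (A : set R) : \bar R :=
  if s == 0 then \d_m A else normal_prob m s A.

Definition gaussian_rv d (Omega : measurableType d) (R : realType)
    (P : probability Omega R) (X : Omega -> R) : Prop :=
  measurable_fun setT X /\
  exists m s : R, forall A : set R, measurable A ->
    pushforward P X A = gaussian_law m s A.

Definition gaussian_process d (Omega : measurableType d) (R : realType)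
    (P : probability Omega R) (D : set R) (X : R -> {RV P >-> R}) : Prop :=
  forall (n : nat) (c t : 'I_n -> R), (forall i, D (t i)) ->
    gaussian_rv P (fun w => \sum_(i < n) c i * X (t i) w).

(* [B] is indexed by all of [R] but only its values for times in [0, T] are
   constrained or used. *)
Definition brownian_bridge d (Omega : measurableType d) (R : realType)
    (P : probability Omega R) (T y : R) (B : R -> {RV P >-> R}) : Prop :=
  [/\ forall w, {within `[0, T], continuous (fun t : R => B t w)},
      gaussian_process `[0, T] B,
      forall t : R, t \in `[0, T] -> ('E_P[B t] = (y * t / T)%:E)%E &
      forall s t : R, s \in `[0, T] -> t \in `[0, T] ->
        (covariance P (B s) (B t) = (Num.min s t - s * t / T)%:E)%E].

(* First exit time from ]a, b[ of a path [f] living on [0, T].  A bridge whose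
   end point is outside ]a, b[ exits almost surely; on the null set of paths
   that never exit, this is [inf set0 = 0]. *)
Definition exit_time (R : realType) (T a b : R) (f : R -> R) : R :=
  inf [set t : R | t \in `]0, T] /\ f t \notin `]a, b[].

(* For x outside h * Z, [Num.floor (x / h)] is the k with k h < x < (k + 1) h;
   the value on the null set h * Z is irrelevant. *)
Definition cell_exit_time (R : realType) (T h x : R) (f : R -> R) : R :=
  let k : int := Num.floor (x / h) in
  exit_time T (k%:~R * h - x) ((k + 1)%:~R * h - x) f.

(* p_T(0, x) *)
Definition brownian_density (R : realType) (T x : R) : R :=
  (Num.sqrt (2 * pi * T))^-1 * expR (- x ^+ 2 / (2 * T)).

(* Main.v *)
Require Import Defs.
From mathcomp Require Import all_boot all_order all_algebra.
From mathcomp Require Import all_classical all_reals all_analysis.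
From mathcomp Require Import measurable_realfun ring lra.

Set Implicit Arguments.
Unset Strict Implicit.
Unset Printing Implicit Defensive.

Import Order.TTheory GRing.Theory Num.Theory.
Import numFieldNormedType.Exports.

Local Open Scope classical_set_scope.
Local Open Scope ring_scope.

(** Write y = -x for the end point of the bridge, ]lo, up[ for the translated
    cell containing its starting point 0, h for its width and tau for the exit
    time.  Away from the countable set of lattice points the integrand is
    bounded pointwise by h^2 times a polynomial in |x|, and polynomials are
    integrable against the Gaussian density; the work is this pointwise bound.

    The bridge is turned into a martingale by centring and rescaling:
    M_t = (B_t - y t / T) T / (T - t) has independent Gaussian increments, with
    E M_t^2 = t T / (T - t).  Before tau and up to a time T / q, with q of order
    1 + y^2 / T, the path stays in the interval, so M is of order h + |y| t / T.
    Let sigma be tau cut off at T / q.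
    - Stopping M^2 - t T / (T - t) gives E sigma <= E M_sigma^2, and the choice
      of q lets the term in y^2 sigma^2 be absorbed in the left hand side:
      E sigma = O(h^2).
    - Stopping M gives E M_sigma = 0.  Since B_t and M_t differ by
      O(t (h + |y|)) as long as the path is in the interval, and since
      sigma = T / q when the exit is later than T / q,
      |E B_tau| <= O(1 + y^2) E sigma.

    Both stopping identities are applied in discrete form, on a grid of step
    T / N, to the number of grid times up to which the whole path has stayed
    inside the interval (path_square, path_exit_value, discrete_exit_mean).
    The overshoot of one grid step is controlled by the sum of the fourth powers
    of the increments, whose mean is O(1 / N), and the discrete exit values
    converge to B_tau by continuity of the paths (exit_mean_bound).

    What makes the stopping identities work is that an increment of M is
    orthogonal to the event that the path has stayed in the interval so far.
    An increment X is uncorrelated with the past, so the Gaussian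
    characteristic function gives
    E [X sin (V + c)] = E [(X^2 - E X^2) sin (V + c)] = 0 for each linear
    combination V of past values (innovation_orthogonal,
    innovation_sqr_orthogonal).  By the addition formulas this orthogonality is
    inherited after multiplication by sines of past values, hence by polynomials
    in them and by bounded pointwise limits (adapted_preserves), and the survival
    event is reached in this way (adapted_survives). *)

(** * Integrability and dominated convergence for real functions *)

Section dominated_convergence_real.
Context d (T : measurableType d) (R : realType).
Variable mu : {measure set T -> \bar R}.

Lemma dominated_cvg_Rintegral (u : nat -> T -> R) (f g : T -> R) :
  (forall n, measurable_fun setT (u n)) ->
  (forall x, u n x @[n --> \oo] --> f x) ->
  mu.-integrable setT (EFin \o g) ->
  (forall n x, `|u n x| <= g x) ->
  mu.-integrable setT (EFin \o f) /\
  \int[mu]_x u n x @[n --> \oo] --> \int[mu]_x f x.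
Proof.
move=> mu_ uf ig ug.
have mf : measurable_fun setT f.
  apply/measurable_EFinP; apply: (emeasurable_fun_cvg (fun n => EFin \o u n)).
    by move=> n; apply/measurable_EFinP; exact: mu_.
  by move=> x _; apply/cvg_EFin; [exact: nearW|exact: uf].
have [] := @dominated_convergence _ _ _ mu setT measurableT
  (fun n x => (u n x)%:E) (EFin \o f) (EFin \o g) => //.
- by move=> n; apply/measurable_EFinP; exact: mu_.
- exact/measurable_EFinP.
- by apply: aeW => x _; apply/cvg_EFin; [exact: nearW|exact: uf].
- by apply: aeW => x n _; rewrite lee_fin; exact: ug.
move=> ifi _ c; split => //.
apply: fine_cvg => //.
by rewrite fineK//; exact: integrable_fin_num.
Qed.

End dominated_convergence_real.

Section integrable_real.
Context d (T : measurableType d) (R : realType).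
Variable mu : {measure set T -> \bar R}.
Implicit Types f g : T -> R.
Local Notation L1 f := (mu.-integrable setT (EFin \o f)).

Lemma L1_measurable f : L1 f -> measurable_fun setT f.
Proof. by move=> /(measurable_int mu)/measurable_EFinP. Qed.

Lemma L1_Zl (k : R) f : L1 f -> L1 (fun x => k * f x).
Proof.
move=> intf.
by have := @integrableZl _ _ _ mu setT measurableT k _ intf.
Qed.

Lemma L1_D f g : L1 f -> L1 g -> L1 (fun x => f x + g x).
Proof.
move=> intf intg.
by have := @integrableD _ _ _ mu setT measurableT _ _ intf intg.
Qed.

Lemma L1_B f g : L1 f -> L1 g -> L1 (fun x => f x - g x).
Proof.
move=> intf intg.
by have := @integrableB _ _ _ mu setT measurableT _ _ intf intg.
Qed.

Lemma L1_norm f : L1 f -> L1 (fun x => `|f x|).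
Proof. exact: integrable_norm. Qed.

Lemma L1_sum I (s : seq I) (h : I -> T -> R) :
  (forall i, L1 (h i)) -> L1 (fun x => \sum_(i <- s) h i x).
Proof.
move=> inth; elim: s => [|i s IH].
  by under eq_fun do rewrite big_nil; have := @integrable0 _ _ _ mu setT.
by under eq_fun do rewrite big_cons; exact: L1_D.
Qed.

Lemma L1_le f g : measurable_fun setT f -> L1 g ->
  (forall x, `|f x| <= g x) -> L1 f.
Proof.
move=> mf intg fg; apply: (le_integrable measurableT _ _ intg).
  exact/measurable_EFinP.
by move=> x _; rewrite /= lee_fin (le_trans (fg x))// ler_norm.
Qed.

Lemma L1_bounded_Mr f g (M : R) : L1 f -> measurable_fun setT g ->
  (forall x, `|g x| <= M) -> L1 (fun x => f x * g x).
Proof.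
move=> intf mg gM; apply: (L1_le _ (L1_Zl M (L1_norm intf))).
  by apply: measurable_funM => //; exact: L1_measurable.
by move=> x; rewrite normrM mulrC ler_wpM2r.
Qed.

End integrable_real.

(** * Integrals against the normal density *)

Section gaussian_line.
Context {R : realType}.
Implicit Types (m s u x c t : R) (k : nat).
Notation mu := (@lebesgue_measure R).

Lemma ler_eq_imp (a b : R) : a = b -> a <= b.
Proof. by move=> ->. Qed.

Lemma exprn_le_expR k u : 0 <= u -> u ^+ k <= k`!%:R * expR u.
Proof.
move=> u0; have f0 : 0 < k`!%:R :> R by rewrite ltr0n fact_gt0.
case: k f0 => [|k] f0; first by rewrite expr0 mul1r (le_trans _ (expR_ge1Dx u)) ?lerDl.
have := expR_ge1Dxn k u0.
rewrite -(ler_pM2l f0); apply: le_trans.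
rewrite mulrDr mulrCA divff ?gt_eqF// !mulr1 lerDr; exact: ltW.
Qed.

(** Half of the Gaussian exponent pays for the polynomial factor. *)
Lemma exprn_normal_pdf_le s k : s != 0 -> exists C : R, 0 <= C /\
  forall m x, `|x - m| ^+ k * normal_pdf m s x <=
              C * normal_pdf m (s * Num.sqrt 2) x.
Proof.
move=> s0; have r0 : Num.sqrt 2 != 0 :> R by rewrite gt_eqF ?sqrtr_gt0.
have s20 : s * Num.sqrt 2 != 0 by rewrite mulf_neq0.
set a : R := s ^+ 2 *+ 4.
have a0 : 0 < a by rewrite pmulrn_lgt0// exprn_even_gt0.
(* (x - m)^2 / a is half of the Gaussian exponent; its k-th power is below
   k! times its exponential, and |x - m|^k is the square root of
   a^k ((x - m)^2 / a)^k. *)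
exists (normal_peak s / normal_peak (s * Num.sqrt 2) * (1 + k`!%:R * a ^+ k)).
split.
  rewrite mulr_ge0 ?divr_ge0 ?normal_peak_ge0// addr_ge0//.
  by rewrite mulr_ge0 ?ler0n// exprn_ge0// ltW.
move=> m x; rewrite !normal_pdfE// /normal_fun.
have p0 := normal_peak_gt0 s0; have p20 := normal_peak_gt0 s20.
set v := (x - m) ^+ 2 / a.
have v0 : 0 <= v by rewrite divr_ge0 ?sqr_ge0// ltW.
have -> : - (x - m) ^+ 2 / (s ^+ 2 *+ 2) = - v - v.
  by rewrite /v /a; field; rewrite s0.
have -> : - (x - m) ^+ 2 / ((s * Num.sqrt 2) ^+ 2 *+ 2) = - v.
  rewrite exprMn sqr_sqrtr ?ler0n// /v /a; by field; rewrite s0.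
rewrite expRD.
have key : `|x - m| ^+ k * expR (- v) <= 1 + k`!%:R * a ^+ k.
  rewrite expRN ler_pdivrMr ?expR_gt0//.
  have -> : `|x - m| ^+ k = Num.sqrt (a ^+ k * v ^+ k).
    rewrite -exprMn /v mulrCA divff ?gt_eqF// mulr1 -exprM mulnC exprM.
    by rewrite sqrtr_sqr normrX.
  have ev : 1 <= expR v by rewrite -expR0 ler_expR.
  have ak : 0 <= a ^+ k by rewrite exprn_ge0// ltW.
  have sq (z : R) : 0 <= z -> Num.sqrt z <= 1 + z.
    move=> z0; rewrite -[leRHS]ger0_norm ?addr_ge0// -sqrtr_sqr ler_wsqrtr//.
    by have := sqr_ge0 z; lra.
  apply: (le_trans (sq _ _)); first by rewrite mulr_ge0// exprn_ge0.
  rewrite mulrDl mul1r lerD//.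
  rewrite [leRHS](_ : _ = a ^+ k * (k`!%:R * expR v)); last by ring.
  by rewrite ler_wpM2l// exprn_le_expR.
rewrite -/(normal_fun _ _ _).
apply: (@le_trans _ _ (normal_peak s * expR (- v) * (`|x - m| ^+ k * expR (- v)))).
  by apply: ler_eq_imp; ring.
apply: (@le_trans _ _ (normal_peak s * expR (- v) * (1 + k`!%:R * a ^+ k))).
  by rewrite ler_wpM2l// mulr_ge0 ?expR_ge0 ?normal_peak_ge0.
by apply: ler_eq_imp; field; rewrite gt_eqF.
Qed.

Lemma integrable_exprn_normal_pdf m s k : s != 0 ->
  mu.-integrable setT (EFin \o (fun x => (x - m) ^+ k * normal_pdf m s x)).
Proof.
move=> s0; have [C [C0 HC]] := exprn_normal_pdf_le k s0.
apply: (@L1_le _ (measurableTypeR R) R mu _ (fun x => C * normal_pdf m (s * Num.sqrt 2) x)).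
- apply: measurable_funM; last exact: measurable_normal_pdf.
  by apply: measurable_funX; exact: measurable_funB.
- by apply: L1_Zl; exact: integrable_normal_pdf.
- move=> x; rewrite normrM normrX (ger0_norm (normal_pdf_ge0 _ _ _)).
  exact: HC.
Qed.

(** Fundamental theorem of calculus on the whole line: the integrals over
    [[-n, n]] converge by dominated convergence. *)
Lemma integral_derivative_line (F f : R -> R) :
  (forall x, is_derive x 1 F (f x)) -> continuous f ->
  mu.-integrable setT (EFin \o f) ->
  F n%:R @[n --> \oo] --> 0 -> F (- n%:R) @[n --> \oo] --> 0 ->
  \int[mu]_x f x = 0.
Proof.
move=> dF cf intf Fp Fm.
pose I n : set R := `[- n.+1%:R, n.+1%:R]%classic.
have key n : \int[mu]_x (f x * \1_(I n) x) = F n.+1%:R - F (- n.+1%:R).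
  have -> : \int[mu]_x (f x * \1_(I n) x) = \int[mu]_(x in I n) f x.
    rewrite [RHS]Rintegral_mkcond; apply: eq_Rintegral => x _.
    by rewrite patchE indicE; case: (x \in I n); rewrite ?mulr1 ?mulr0.
  rewrite /Rintegral (@continuous_FTC2 R f F (- n.+1%:R) n.+1%:R)//.
  - by rewrite -subr_gt0 opprK addr_gt0// ltr0n.
  - exact: continuous_subspaceT.
  - split => //.
    + apply: cvg_at_right_filter. 
      by apply/differentiable_continuous/derivable1_diffP; exact: ex_derive.
    + apply: cvg_at_left_filter.
      by apply/differentiable_continuous/derivable1_diffP; exact: ex_derive.
  - by move=> x _; rewrite derive1E; exact: derive_val.
have c1 : \int[mu]_x (f x * \1_(I n) x) @[n --> \oo] --> (0 : R).
  have -> : (fun n => \int[mu]_x (f x * \1_(I n) x)) =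
      (fun n => F n.+1%:R - F (- n.+1%:R)) by apply/funext.
  have -> : 0 = 0 - 0 :> R by rewrite subr0.
  by apply: (@cvgB _ R^o); [move: Fp|move: Fm]; rewrite -cvg_shiftS.
have [||||_ c2] := @dominated_cvg_Rintegral _ _ _ mu
  (fun n x => f x * \1_(I n) x) f (fun x => `|f x|).
- move=> n; apply: measurable_funM; last by apply: measurable_indic; exact: measurable_itv.
  exact: measurable_realfun.continuous_measurable_fun.
- move=> x; apply/cvgrPdist_lt => e e0; near=> n.
  rewrite indicE mem_set ?mulr1 ?subrr ?normr0//.
  rewrite /I /= in_itv /= -ler_norml.
  near: n; exists (Num.truncn `|x|) => // n /= xn.
  by rewrite ltW// (lt_le_trans (truncnS_gt _))// ler_nat.
- exact: (integrable_norm intf).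
- move=> n x; rewrite normrM ler_piMr// indicE; by case: (_ \in _); rewrite ?normr1 ?normr0.
exact: (cvg_unique _ c2 c1).
Unshelve. all: end_near. Qed.

End gaussian_line.

Section stein.
Context {R : realType}.
Implicit Types (m s u x c t : R) (k : nat).
Notation mu := (@lebesgue_measure R).

Lemma is_derive_normal_pdf m s x : s != 0 ->
  is_derive x 1 (normal_pdf m s) (- ((x - m) / s ^+ 2) * normal_pdf m s x).
Proof.
move=> s0; rewrite normal_pdfE// /normal_fun.
apply: is_derive_eq.
rewrite !(derive_val, scaler0, scaler1, addr0, subr0, oppr0) /GRing.scale /=.
field. by rewrite s0.
Qed.

Lemma cvg_nat_decay (F : R -> R) m D : (forall x, `|x - m| * `|F x| <= D) ->
  F n%:R @[n --> \oo] --> 0 /\ F (- n%:R) @[n --> \oo] --> 0.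
Proof.
move=> FD.
have D0 : 0 <= D by apply: le_trans (FD m); rewrite mulr_ge0.
have small e x : 0 < e -> D / e < `|x - m| -> `|0 - F x| < e.
  move=> e0; rewrite ltr_pdivrMr// sub0r normrN => De.
  have xm : 0 < `|x - m|.
    rewrite lt_neqAle normr_ge0 andbT eq_sym; apply/eqP => xm.
    by move: De; rewrite xm mul0r ltNge D0.
  by rewrite -(ltr_pM2l xm); apply: le_lt_trans (FD x) De.
split; apply/cvgrPdist_lt => e e0; exists (Num.truncn (D / e + `|m|)).+1 => //= n nN;
  apply: small => //; apply: (@lt_le_trans _ _ (n%:R - `|m|)).
- rewrite ltrBrDr (lt_le_trans (truncnS_gt _))// ler_nat//.
- rewrite -[n%:R in leLHS]ger0_norm// (le_trans (lerB_dist _ _))//.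
- rewrite ltrBrDr (lt_le_trans (truncnS_gt _))// ler_nat//.
- rewrite -[n%:R in leLHS]ger0_norm// -opprD normrN (le_trans (lerB_normD _ _))//.
Qed.

(** Gaussian integration by parts: g' - (x - m) / s^2 g times the density is the
    derivative of g times the density, which vanishes at infinity. *)
Lemma normal_stein m s (g g' : R -> R) C : s != 0 ->
  (forall x, is_derive x 1 g (g' x)) -> continuous g' ->
  (forall x, `|g x| <= C * (1 + (x - m) ^+ 4)) ->
  (forall x, `|g' x| <= C * (1 + (x - m) ^+ 4)) ->
  \int[mu]_x (g' x * normal_pdf m s x) =
  \int[mu]_x ((x - m) * g x * normal_pdf m s x) / s ^+ 2.
Proof.
move=> s0 dg cg' gC g'C.
have cg : continuous g.
  by move=> x; apply/differentiable_continuous/derivable1_diffP.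
have mg : measurable_fun setT g by exact: continuous_measurable_fun.
have mg' : measurable_fun setT g' by exact: continuous_measurable_fun.
have mphi := @measurable_normal_pdf R m s.
have phi0 x := @normal_pdf_ge0 R m s x.
have mxm : measurable_fun setT (fun x => x - m) by exact: measurable_funB.
pose L f := mu.-integrable setT (EFin \o f).
have X k : L (fun x => (x - m) ^+ k * normal_pdf m s x).
  exact: integrable_exprn_normal_pdf.
have i1 : L (fun x => g' x * normal_pdf m s x).
  apply: (@L1_le _ (measurableTypeR R) R mu _ (fun x => C *
    ((x - m) ^+ 0 * normal_pdf m s x + (x - m) ^+ 4 * normal_pdf m s x))).
  - exact: measurable_funM.
  - by apply: L1_Zl; apply: L1_D; exact: X.
  - move=> x; rewrite expr0 -mulrDl mulrA normrM (ger0_norm (phi0 x)).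
    by rewrite ler_wpM2r.
have i2 : L (fun x => (x - m) * g x * normal_pdf m s x).
  apply: (@L1_le _ (measurableTypeR R) R mu _ (fun x => C *
    (((x - m) ^+ 0 * normal_pdf m s x + (x - m) ^+ 2 * normal_pdf m s x) +
     ((x - m) ^+ 4 * normal_pdf m s x + (x - m) ^+ 6 * normal_pdf m s x)))).
  - by apply: measurable_funM => //; exact: measurable_funM.
  - by apply: L1_Zl; apply: L1_D; apply: L1_D; exact: X.
  - move=> x; rewrite -!mulrDl mulrA !normrM (ger0_norm (phi0 x)) ler_wpM2r//.
    have -> : C * ((x - m) ^+ 0 + (x - m) ^+ 2 + ((x - m) ^+ 4 + (x - m) ^+ 6)) =
      (1 + (x - m) ^+ 2) * (C * (1 + (x - m) ^+ 4)) by ring.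
    apply: ler_pM => //.
    rewrite -(real_normK (num_real (x - m))).
    by have := sqr_ge0 (`|x - m| - 1); have := normr_ge0 (x - m); nra.
have := @integral_derivative_line R (fun x => g x * normal_pdf m s x)
  (fun x => g' x * normal_pdf m s x - s ^- 2 * ((x - m) * g x * normal_pdf m s x)).
have [C1 [C10 HC1]] := exprn_normal_pdf_le 1 s0.
have [C5 [C50 HC5]] := exprn_normal_pdf_le 5 s0.
have C0 : 0 <= C.
  have := gC m; rewrite subrr expr0n/= addr0 mulr1.
  by apply: le_trans.
have s20 : s * Num.sqrt 2 != 0 by rewrite mulf_neq0// gt_eqF ?sqrtr_gt0.
have decay x : `|x - m| * `|g x * normal_pdf m s x| <=
    C * ((C1 + C5) * normal_peak (s * Num.sqrt 2)).
  rewrite normrM (ger0_norm (phi0 x)).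
  apply: (@le_trans _ _ (C * (`|x - m| ^+ 1 * normal_pdf m s x +
    `|x - m| ^+ 5 * normal_pdf m s x))).
    rewrite -mulrDl !mulrA ler_wpM2r//.
    have -> : C * (`|x - m| ^+ 1 + `|x - m| ^+ 5) = `|x - m| * (C * (1 + `|x - m| ^+ 4)).
      by ring.
    rewrite ler_wpM2l//; apply: le_trans (gC x) _.
    by rewrite ler_wpM2l// lerD2l -normrX ler_norm.
  rewrite ler_wpM2l// mulrDl lerD//.
    by apply: le_trans (HC1 m x) _; rewrite ler_wpM2l// normal_pdf_ub.
  by apply: le_trans (HC5 m x) _; rewrite ler_wpM2l// normal_pdf_ub.
have [Fp Fm] := cvg_nat_decay decay.
move=> /(_ _ _ _ Fp Fm) H.
have : \int[mu]_x (g' x * normal_pdf m s x - s ^- 2 * ((x - m) * g x * normal_pdf m s x)) = 0.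
  apply: H.
  - move=> x; have dphi := is_derive_normal_pdf m x s0.
    have D := is_deriveM (dg x) dphi.
    apply: is_derive_eq.
    by rewrite /GRing.scale/=; field; rewrite s0.
  - have cp := @continuous_normal_pdf R m s s0.
    move=> x; apply: (@cvgB _ R^o); first exact: cvgM (cg' x) (cp x).
    apply: cvgM; first exact: cvg_cst.
    apply: cvgM (cp x); apply: cvgM (cg x).
    by apply: (@cvgB _ R^o) => //; exact: cvg_cst.
  - by apply: L1_B => //; exact: L1_Zl.
rewrite RintegralB//; last exact: L1_Zl.
rewrite RintegralZl// => /eqP; rewrite subr_eq0 => /eqP ->.
by rewrite mulrC.
Qed.

End stein.

Section normal_moments.
Context {R : realType}.
Implicit Types (m s u x c t : R) (k : nat).
Notation mu := (@lebesgue_measure R).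

Lemma normal_moment0 m s : \int[mu]_x normal_pdf m s x = 1.
Proof. by rewrite /Rintegral integral_normal_pdf. Qed.

(* The moments are integrations by parts of 1, x - m and (x - m)^3. *)
Lemma normal_moment1 m s : s != 0 -> \int[mu]_x ((x - m) * normal_pdf m s x) = 0.
Proof.
move=> s0.
have H : \int[mu]_x (0 * normal_pdf m s x) =
    \int[mu]_x ((x - m) * 1 * normal_pdf m s x) / s ^+ 2.
  apply: (@normal_stein R m s (cst 1) (cst 0) 1 s0).
  - by move=> x; exact: cvg_cst.
  - by move=> x; rewrite normr1 mul1r lerDl exprn_even_ge0.
  - by move=> x; rewrite normr0 mul1r addr_ge0// exprn_even_ge0.
under eq_Rintegral do rewrite -[X in X * _]mulr1.
rewrite -(divfK (expf_neq0 2 s0) (Rintegral _ _ _)) -H.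
under eq_Rintegral do rewrite mul0r.
by rewrite Rintegral_cst// !mul0r.
Qed.

Lemma normal_moment2 m s : s != 0 ->
  \int[mu]_x ((x - m) ^+ 2 * normal_pdf m s x) = s ^+ 2.
Proof.
move=> s0.
have H : \int[mu]_x (1 * normal_pdf m s x) =
    \int[mu]_x ((x - m) * (x - m) * normal_pdf m s x) / s ^+ 2.
  apply: (@normal_stein R m s (fun x => x - m) (cst 1) 2 s0).
  - by move=> x; apply: is_derive_eq; rewrite subr0.
  - by move=> x; exact: cvg_cst.
  - move=> x; rewrite -[(x - m) ^+ 4]ger0_norm ?exprn_even_ge0// normrX.
    have := normr_ge0 (x - m); set u := `|_|; move=> u0.
    have -> : u ^+ 4 = (u ^+ 2) ^+ 2 by rewrite -exprM.
    have := sqr_ge0 (u - 1); have := sqr_ge0 (u ^+ 2 - 1); have := sqr_ge0 u.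
    by nra.
  - move=> x; rewrite normr1.
    have : 0 <= (x - m) ^+ 4 by rewrite exprn_even_ge0.
    lra.
rewrite -(divfK (expf_neq0 2 s0) (Rintegral _ _ _)).
under eq_Rintegral do rewrite expr2.
rewrite -H; under eq_Rintegral do rewrite mul1r.
by rewrite normal_moment0 mul1r.
Qed.

Lemma normal_moment4 m s : s != 0 ->
  \int[mu]_x ((x - m) ^+ 4 * normal_pdf m s x) = 3 * s ^+ 4.
Proof.
move=> s0.
have := @normal_stein R m s (fun x => (x - m) ^+ 3) (fun x => 3 * (x - m) ^+ 2) 3 s0.
under eq_Rintegral do rewrite -mulrA.
rewrite RintegralZl//; last exact: integrable_exprn_normal_pdf.
rewrite normal_moment2// => H.
have {H} : 3 * s ^+ 2 =
    \int[mu]_x ((x - m) * (x - m) ^+ 3 * normal_pdf m s x) / s ^+ 2.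
  apply: H.
  - move=> x; apply: is_derive_eq.
    by rewrite subr0 /GRing.scale/=; ring.
  - move=> x; apply: cvgM; first exact: cvg_cst.
    apply: (@cvg_comp _ _ _ (fun x => x - m) (fun x => x ^+ 2)); last exact: sqr_continuous.
    by apply: (@cvgB _ R^o) => //; exact: cvg_cst.
  - move=> x; rewrite normrX -[(x - m) ^+ 4]ger0_norm ?exprn_even_ge0// normrX.
    have := normr_ge0 (x - m); set u := `|_|; move=> u0.
    have : u ^+ 3 <= 1 + u ^+ 4.
      case: (lerP u 1) => u1.
        have : u ^+ 3 <= 1 by rewrite exprn_ile1.
        have : 0 <= u ^+ 4 by rewrite exprn_ge0.
        lra.
      have : u ^+ 3 <= u ^+ 4 by rewrite ler_eXn2l// ltW.
      lra.
    have : 0 <= u ^+ 4 by rewrite exprn_ge0.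
    lra.
  - move=> x; rewrite normrM ger0_norm ?ler0n// ler_wpM2l// ger0_norm ?sqr_ge0//.
    have -> : (x - m) ^+ 4 = ((x - m) ^+ 2) ^+ 2 by rewrite -exprM.
    have := sqr_ge0 ((x - m) ^+ 2 - 1); have := sqr_ge0 (x - m); nra.
move=> H.
have -> : \int[mu]_x ((x - m) ^+ 4 * normal_pdf m s x) =
    \int[mu]_x ((x - m) * (x - m) ^+ 3 * normal_pdf m s x).
  by apply: eq_Rintegral => x _; rewrite -exprS.
have -> : 3 * s ^+ 4 = 3 * s ^+ 2 * s ^+ 2 by ring.
by rewrite H divfK// expf_neq0.
Qed.

(** Differentiating under the integral and integrating by parts shows that the
    integral solves F' = - s^2 t F in the variable [t].  The phase [c] treats sine
    and cosine at once. *)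
Lemma normal_cos m s c t : s != 0 ->
  \int[mu]_x (cos (t * (x - m) + c) * normal_pdf m s x) =
  expR (- (s ^+ 2 * t ^+ 2 / 2)) * cos c.
Proof.
move=> s0.
have phi0 x := @normal_pdf_ge0 R m s x.
pose f t x := cos (t * (x - m) + c) * normal_pdf m s x.
have mf t' : measurable_fun setT (f t').
  apply: measurable_funM; last exact: measurable_normal_pdf.
  apply: continuous_measurable_fun => x; apply: continuous_comp; last exact: continuous_cos.
  apply: (@cvgD _ R^o); last exact: cvg_cst.
  by apply: cvgM; [exact: cvg_cst|apply: (@cvgB _ R^o) => //; exact: cvg_cst].
have intf t' : mu.-integrable setT (EFin \o f t').
  apply: (@L1_le _ (measurableTypeR R) R mu _ (normal_pdf m s)) => //.
  - exact: (mf t').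
  - exact: integrable_normal_pdf.
  - by move=> x; rewrite normrM (ger0_norm (phi0 x)) ler_piMl// cos_max.
pose F t := \int[mu]_x f t x.
have df : forall z u, is_derive u 1 (f ^~ z)
    (- ((z - m) * sin (u * (z - m) + c) * normal_pdf m s z)).
  move=> z u.
  apply: is_derive_eq; rewrite /GRing.scale/=; ring.
have dF : forall t', is_derive t' 1 F (- (s ^+ 2 * t') * F t').
  move=> t'.
  have It' : (`]t' - 1, t' + 1[)%classic t' by rewrite /= in_itv/=; lra.
  have d1 x t'' : partial1of2 f t'' x =
      - ((x - m) * sin (t'' * (x - m) + c) * normal_pdf m s x).
    by rewrite partial1of2E; have := df x t'' => ?; rewrite derive_val.
  have i1 : mu.-integrable setT (EFin \o (fun x => `|(x - m) ^+ 1 * normal_pdf m s x|)).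
    by apply: integrable_norm; exact: integrable_exprn_normal_pdf.
  have bnd x t'' : `|partial1of2 f t'' x| <= `|(x - m) ^+ 1 * normal_pdf m s x|.
    rewrite d1 normrN !normrM (ger0_norm (phi0 x)) expr1 ler_wpM2r//.
    by rewrite ler_piMr// sin_max.
  have D1 : derivable F t' 1.
    apply: (@derivable_under_integral R _ _ mu f setT measurableT t' (t' - 1) (t' + 1)
      It' _ _ (fun x => `|(x - m) ^+ 1 * normal_pdf m s x|)) => //.
  split; first by [].
  transitivity (F^`()%classic t'); first by rewrite derive1E.
  transitivity (\int[mu]_x partial1of2 f t' x).
    apply: (@differentiation_under_integral R _ _ mu f setT measurableT t'
      (t' - 1) (t' + 1) It' _ _ (fun x => `|(x - m) ^+ 1 * normal_pdf m s x|)) => //.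
  transitivity (\int[mu]_x - ((x - m) * sin (t' * (x - m) + c) * normal_pdf m s x)).
    by apply: eq_Rintegral => x _; exact: d1.
  have H : \int[mu]_x (t' * cos (t' * (x - m) + c) * normal_pdf m s x) =
      \int[mu]_x ((x - m) * sin (t' * (x - m) + c) * normal_pdf m s x) / s ^+ 2.
    apply: (@normal_stein R m s (fun x => sin (t' * (x - m) + c))
      (fun x => t' * cos (t' * (x - m) + c)) (1 + `|t'|) s0).
    - by move=> x; apply: is_derive_eq; rewrite /GRing.scale/=; ring.
    - move=> x; apply: cvgM; first exact: cvg_cst.
      apply: continuous_comp; last exact: continuous_cos.
      apply: (@cvgD _ R^o); last exact: cvg_cst.
      by apply: cvgM; [exact: cvg_cst|apply: (@cvgB _ R^o) => //; exact: cvg_cst].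
    - move=> x; apply: le_trans (sin_max _) _.
      have : 0 <= (x - m) ^+ 4 by rewrite exprn_even_ge0.
      by have := normr_ge0 t'; nra.
    - move=> x; rewrite normrM.
      have : 0 <= (x - m) ^+ 4 by rewrite exprn_even_ge0.
      have := cos_max (t' * (x - m) + c); have := normr_ge0 t'.
      by have := normr_ge0 (cos (t' * (x - m) + c)); nra.
  have i2 : mu.-integrable setT (EFin \o (fun x =>
      (x - m) * sin (t' * (x - m) + c) * normal_pdf m s x)).
    apply: (@L1_le _ (measurableTypeR R) R mu _ (fun x => `|(x - m) ^+ 1 * normal_pdf m s x|)) => //.
    - apply: measurable_funM; last exact: measurable_normal_pdf.
      apply: continuous_measurable_fun => x.
      have cxm : {for x, continuous (fun x => x - m)}.
        by apply: (@cvgB _ R^o) => //; exact: cvg_cst.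
      apply: cvgM; first exact: cxm.
      apply: continuous_comp; last exact: continuous_sin.
      apply: (@cvgD _ R^o); last exact: cvg_cst.
      by apply: cvgM; [exact: cvg_cst|exact: cxm].
    - by move=> x; rewrite -normrN -d1.
  have -> : \int[mu]_x - ((x - m) * sin (t' * (x - m) + c) * normal_pdf m s x) =
      - \int[mu]_x ((x - m) * sin (t' * (x - m) + c) * normal_pdf m s x).
    under eq_Rintegral do rewrite -mulN1r.
    by rewrite RintegralZl// mulN1r.
  rewrite -[X in - X](divfK (expf_neq0 2 s0)) -H.
  under [in LHS]eq_Rintegral do rewrite -mulrA.
  rewrite RintegralZl; [|by []|exact: intf].
  rewrite /F /f; ring.
have dH : forall t', is_derive t' 1 (fun t => expR (s ^+ 2 * t ^+ 2 / 2) * F t) 0.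
  move=> t'.
  have := dF t' => ?.
  apply: is_derive_eq; rewrite /GRing.scale/=.
  by field.
have := @is_derive_0_is_cst R _ t 0 dH.
rewrite expr0n/= mulr0 mul0r expR0 mul1r => H0.
rewrite -[LHS]/(F t) -[LHS](mulKf (lt0r_neq0 (expR_gt0 (s ^+ 2 * t ^+ 2 / 2)))) H0 expRN.
congr (_ * _); rewrite /F /f.
under eq_Rintegral do rewrite mul0r add0r.
rewrite RintegralZl//; last exact: integrable_normal_pdf.
by rewrite normal_moment0 mulr1.
Qed.

End normal_moments.

(** * Gaussian random variables *)

Section normal_prob_integral.
Context {R : realType}.
Notation mu := (@lebesgue_measure R).

(** The normal density is almost everywhere the Radon-Nikodym derivative. *)
Lemma ge0_integral_normal_prob (m s : R) (f : R -> \bar R) :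
  (forall x, 0 <= f x)%E -> measurable_fun setT f ->
  (\int[normal_prob m s]_x f x = \int[mu]_x (f x * (normal_pdf m s x)%:E))%E.
Proof.
move=> f0 mf.
have dom := @normal_prob_dominates R m s.
rewrite -(Radon_Nikodym_SigmaFinite.change_of_variables dom)//.
have mpdf : measurable_fun setT (fun x => (normal_pdf m s x)%:E).
  by apply/measurable_EFinP; exact: measurable_normal_pdf.
have ih := Radon_Nikodym_SigmaFinite.f_integrable dom.
apply: ae_eq_integral => //.
- by apply: emeasurable_funM => //; exact: (measurable_int mu ih).
- exact: emeasurable_funM.
- apply: ae_eqe_mul2l.
  apply: integral_ae_eq => //.
  by move=> E _ mE; rewrite -Radon_Nikodym_SigmaFinite.f_integral.
Qed.

Lemma integrable_normal_prob (m s : R) (g : R -> R) :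
  measurable_fun setT g ->
  mu.-integrable setT (EFin \o (fun x => g x * normal_pdf m s x)) ->
  (normal_prob m s).-integrable setT (EFin \o g) /\
  \int[normal_prob m s]_x g x = \int[mu]_x (g x * normal_pdf m s x).
Proof.
move=> mg ig.
have phi0 x := @normal_pdf_ge0 R m s x.
have mge : measurable_fun setT (EFin \o g) by exact/measurable_EFinP.
split.
  apply/integrableP; split => //.
  rewrite ge0_integral_normal_prob//; last exact: measurableT_comp.
  move/integrableP : ig => [_]; congr (_ < _)%E.
  by apply: eq_integral => x _; rewrite /= normrM EFinM (ger0_norm (phi0 x)).
congr fine; rewrite integralE [RHS]integralE.
rewrite !ge0_integral_normal_prob//.
- congr (_ - _)%E; apply: eq_integral => x _.
    by rewrite !funeposE /= -!EFin_max -EFinM maxr_pMl// mul0r.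
  by rewrite !funenegE /= -!EFin_max -EFinM maxr_pMl// mul0r mulNr.
- exact: measurable_funeneg.
- exact: measurable_funepos.
Qed.

End normal_prob_integral.

Section gaussian_variables.
Context d (Om : measurableType d) (R : realType) (P : probability Om R).
Local Notation L1 f := (P.-integrable setT (EFin \o f)).

Lemma transfer_law d' (Y : measurableType d') (nu : {measure set Y -> \bar R})
    (X : Om -> Y) (g : Y -> R) :
  measurable_fun setT X -> measurable_fun setT g ->
  (forall A : set Y, measurable A -> pushforward P X A = nu A) ->
  nu.-integrable setT (EFin \o g) ->
  L1 (g \o X) /\ \int[P]_w g (X w) = \int[nu]_x g x.
Proof.
move=> mX mg lawX ig.
have mge : measurable_fun setT (EFin \o g) by exact/measurable_EFinP.
have mgX : measurable_fun setT (g \o X) by exact: measurableT_comp.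
have iX : L1 (g \o X).
  apply/integrableP; split; first exact/measurable_EFinP.
  have := @ge0_integral_pushforward _ _ _ _ R X mX P setT (fun x => `|(g x)%:E|%E)
    measurableT.
  rewrite preimage_setT /= => <- //; last exact/measurable_EFinP/measurableT_comp.
  rewrite (eq_measure_integral nu); last by move=> A mA _; exact: lawX.
  by case/integrableP : ig.
split => //; congr fine.
have := @integral_pushforward _ _ _ _ R X mX P setT (EFin \o g) mge.
rewrite preimage_setT => /(_ iX measurableT) /= <-.
by apply: eq_measure_integral => A mA _; exact: lawX.
Qed.

(** The consequences of normality used below; they hold for the Dirac mass, the
    case v = 0, as well. *)
Record gaussian_with (X : Om -> R) (m v : R) : Prop := GaussianWith {
  gaussian_var_ge0 : 0 <= v ;
  gaussian_measurable : measurable_fun setT X ;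
  gaussian_L4 : L1 (fun w => (X w - m) ^+ 4) ;
  gaussian_mean : \int[P]_w (X w - m) = 0 ;
  gaussian_var : \int[P]_w ((X w - m) ^+ 2) = v ;
  gaussian_moment4 : \int[P]_w ((X w - m) ^+ 4) = 3 * v ^+ 2 ;
  gaussian_cos : forall c, \int[P]_w cos (X w - m + c) = expR (- (v / 2)) * cos c
}.

Lemma gaussian_rvP (X : Om -> R) : gaussian_rv P X ->
  exists m v : R, gaussian_with X m v.
Proof.
move=> [mX [m [s lawX]]]; exists m, (s ^+ 2).
have mk k : measurable_fun setT (fun x : R => (x - m) ^+ k).
  by apply: measurable_funX; exact: measurable_funB.
have mcos c : measurable_fun setT (fun x : R => cos (x - m + c)).
  apply: measurableT_comp; first by apply: continuous_measurable_fun; exact: continuous_cos.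
  by apply: measurable_funD => //; exact: measurable_funB.
have [s0|s0] := eqVneq s 0.
  have Dirac (g : R -> R) : measurable_fun setT g -> L1 (g \o X) /\ \int[P]_w g (X w) = g m.
    move=> mg.
    have ig : (\d_m : probability _ R).-integrable setT (EFin \o g).
      apply/integrableP; split; first exact/measurable_EFinP.
      rewrite integral_dirac// ?diracT ?mul1e ?ltry//.
      by apply: measurableT_comp => //; exact/measurable_EFinP.
    have lawX' (A : set R) : measurable A -> pushforward P X A = \d_m A.
      by move=> mA; rewrite lawX// /gaussian_law s0 eqxx.
    have [L ->] := transfer_law mX mg lawX' ig; split => //.
    rewrite /Rintegral integral_dirac ?diracT ?mul1e//.
    exact/measurable_EFinP.
  split => //.
  - exact: sqr_ge0.
  - by case: (Dirac _ (mk 4%N)).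
  - by case: (Dirac _ (mk 1%N)) => _; rewrite expr1 subrr => H; rewrite -[RHS]H.
  - by case: (Dirac _ (mk 2%N)) => _ ->; rewrite s0 subrr.
  - by case: (Dirac _ (mk 4%N)) => _ ->; rewrite s0 subrr; ring.
  - move=> c; case: (Dirac _ (mcos c)) => _ ->.
    by rewrite s0 expr0n/= mul0r oppr0 expR0 mul1r subrr add0r.
have lawX' (A : set R) : measurable A -> pushforward P X A = normal_prob m s A.
  by move=> mA; rewrite lawX// /gaussian_law (negbTE s0).
have N (g : R -> R) : measurable_fun setT g ->
    lebesgue_measure.-integrable setT (EFin \o (fun x => g x * normal_pdf m s x)) ->
    L1 (g \o X) /\
    \int[P]_w g (X w) = \int[lebesgue_measure]_x (g x * normal_pdf m s x).
  move=> mg /(integrable_normal_prob mg)[ig <-].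
  exact: (@transfer_law _ (measurableTypeR R) (normal_prob m s) X g mX mg lawX' ig).
have ik k := @integrable_exprn_normal_pdf R m s k s0.
split => //.
- exact: sqr_ge0.
- by case: (N _ (mk 4%N) (ik 4%N)).
- case: (N _ (mk 1%N) (ik 1%N)) => _ H.
  exact: etrans H (normal_moment1 m s0).
- by case: (N _ (mk 2%N) (ik 2%N)) => _ ->; exact: normal_moment2.
- by case: (N _ (mk 4%N) (ik 4%N)) => _ ->; rewrite normal_moment4// -exprM.
- move=> c; case: (N _ (mcos c)) => [|_ ->].
    apply: (@L1_le _ (measurableTypeR R) R _ _ (normal_pdf m s)).
    + by apply: measurable_funM (mcos c) _; exact: measurable_normal_pdf.
    + exact: integrable_normal_pdf.
    + move=> x; rewrite normrM (ger0_norm (normal_pdf_ge0 _ _ _)) ler_piMl//.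
        exact: normal_pdf_ge0.
      exact: cos_max.
  have := @normal_cos R m s c 1 s0.
  by rewrite expr1n mulr1 => <-; apply: eq_Rintegral => x _; rewrite mul1r.
Qed.

End gaussian_variables.

(** * Functions of the past and orthogonality to them *)

Section adapted.
Context d (Om : measurableType d) (R : realType) (P : probability Om R).
Local Notation L1 f := (P.-integrable setT (EFin \o f)).
Implicit Types (F : set (Om -> R)) (U V W Z : Om -> R).

Inductive lin F : (Om -> R) -> Prop :=
| lin0 : lin F (cst 0)
| linD a f V : F f -> lin F V -> lin F (fun w => a * f w + V w).

(** Bounded functions measurable with respect to the variables in F, presented by
    generators instead of a sigma-algebra: orthogonality to all of them is then a
    plain induction. *)
Inductive adapted F : (Om -> R) -> Prop :=
| adapted_sin a f c : F f -> adapted F (fun w => sin (a * f w + c))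
| adapted_cst c : adapted F (cst c)
| adapted_add U V : adapted F U -> adapted F V -> adapted F (fun w => U w + V w)
| adapted_mul U V : adapted F U -> adapted F V -> adapted F (fun w => U w * V w)
| adapted_lim (M : R) (u : nat -> Om -> R) U : (forall n, adapted F (u n)) ->
    (forall n w, `|u n w| <= M) -> (forall w, u n w @[n --> \oo] --> U w) ->
    adapted F U.

(** With c ranging over the reals, both sin (V w) and cos (V w) are covered. *)
Definition trig_orthogonal F Z :=
  L1 Z /\ forall V c, lin F V -> \int[P]_w (Z w * sin (V w + c)) = 0.

Variable F : set (Om -> R).
Hypothesis mF : forall f, F f -> measurable_fun setT f.

Lemma lin_measurable V : lin F V -> measurable_fun setT V.
Proof.
elim=> [|a f {}V Ff _ mV]; first exact: measurable_cst.
apply: measurable_funD => //; apply: measurable_funM => //; exact: mF.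
Qed.

Lemma measurable_sin_comp V : measurable_fun setT V ->
  measurable_fun setT (fun w => sin (V w)).
Proof.
move=> mV; apply: measurableT_comp => //.
by apply: continuous_measurable_fun; exact: continuous_sin.
Qed.

Lemma adapted_measurable U : adapted F U -> measurable_fun setT U.
Proof.
elim=> [a f c Ff|c|V W _ mV _ mW|V W _ mV _ mW|M u {}U _ mu _ uU].
- apply: measurable_sin_comp; apply: measurable_funD => //.
  by apply: measurable_funM => //; exact: mF.
- exact: measurable_cst.
- exact: measurable_funD.
- exact: measurable_funM.
- apply/measurable_EFinP; apply: (emeasurable_fun_cvg (fun n => EFin \o u n)).
    by move=> n; apply/measurable_EFinP; exact: mu.
  by move=> x _; apply/cvg_EFin; [exact: nearW|exact: uU].
Qed.

Lemma adapted_bounded U : adapted F U -> exists M, forall w, `|U w| <= M.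
Proof.
elim=> [a f c Ff|c|V W _ [M HM] _ [N HN]|V W _ [M HM] _ [N HN]|M u {}U _ _ uM uU].
- by exists 1 => w; exact: sin_max.
- by exists `|c|.
- by exists (M + N) => w; rewrite (le_trans (ler_normD _ _))// lerD.
- by exists (M * N) => w; rewrite normrM ler_pM.
- exists M => w; have cn : `|u n w| @[n --> \oo] --> `|U w|.
    by apply: cvg_norm; exact: uU.
  by apply: (cvgr_to_le cn); exact: nearW.
Qed.

(** Multiplication by an adapted variable preserves orthogonality to all the
    trigonometric functions of the past; the generators do so by the product
    formulas for sines, the limits by dominated convergence.  The statement
    must be about all of [trig_orthogonal], not only about the mean, in order to be
    stable under products. *)
Lemma adapted_preserves Z U : trig_orthogonal F Z -> adapted F U ->
  trig_orthogonal F (fun w => Z w * U w).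
Proof.
move=> Z0 aU; elim: aU Z Z0 => {U}.
- move=> a f c Ff Z [LZ HZ]; split.
    apply: (L1_bounded_Mr (M := 1)) => //.
      apply: measurable_sin_comp; apply: measurable_funD => //.
      by apply: measurable_funM => //; exact: mF.
    by move=> w; exact: sin_max.
  move=> V c' lV.
  have H1 := HZ _ (c' - c + pi / 2) (linD (- a) Ff lV).
  have H2 := HZ _ (c' + c + pi / 2) (linD a Ff lV).
  have LS b e : L1 (fun w => Z w * sin (b * f w + V w + e)).
    apply: (L1_bounded_Mr (M := 1)) => //; last by move=> w; exact: sin_max.
    apply: measurable_sin_comp; apply: measurable_funD => //.
    apply: measurable_funD; last exact: lin_measurable.
    by apply: measurable_funM => //; exact: mF.
  transitivity (2^-1 * (\int[P]_w (Z w * sin (- a * f w + V w + (c' - c + pi / 2))) -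
     \int[P]_w (Z w * sin (a * f w + V w + (c' + c + pi / 2))))); last first.
    by rewrite H1 H2 subrr mulr0.
  rewrite -RintegralB// -RintegralZl//; last exact: L1_B.
  apply: eq_Rintegral => w _.
  rewrite !addrA !sinDpihalf.
  rewrite (_ : - a * f w + V w + c' - c = (V w + c') - (a * f w + c)); last by ring.
  rewrite (_ : a * f w + V w + c' + c = (V w + c') + (a * f w + c)); last by ring.
  by rewrite (cosB (V w + c')) (cosD (V w + c')); field.
- move=> c Z [LZ HZ]; split.
    by under eq_fun do rewrite mulrC; exact: L1_Zl.
  move=> V c' lV.
  transitivity (c * \int[P]_w (Z w * sin (V w + c'))); last by rewrite HZ ?mulr0.
  rewrite -RintegralZl//; first by apply: eq_Rintegral => w _; rewrite /= mulrA [c * _]mulrC.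
  apply: (L1_bounded_Mr (M := 1)) => //; last by move=> w; exact: sin_max.
  apply: measurable_sin_comp; apply: measurable_funD => //; exact: lin_measurable.
- move=> U U' _ HU _ HU' Z HZ.
  have [LU OU] := HU _ HZ; have [LU' OU'] := HU' _ HZ; split.
    by under eq_fun do rewrite mulrDr; exact: L1_D.
  move=> V c' lV.
  under eq_Rintegral do rewrite mulrDr mulrDl.
  have ms : measurable_fun setT (fun w => sin (V w + c')).
    by apply: measurable_sin_comp; apply: measurable_funD => //; exact: lin_measurable.
  rewrite RintegralD ?OU ?OU' ?addr0//.
    by apply: (L1_bounded_Mr (M := 1)) => // w; exact: sin_max.
  by apply: (L1_bounded_Mr (M := 1)) => // w; exact: sin_max.
- move=> U U' _ HU _ HU' Z HZ.
  by under eq_fun do rewrite mulrA; exact: HU' (HU _ HZ).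
- move=> M u U au Hu uM uU Z HZ.
  have [LZ OZ] := HZ.
  have mZ := L1_measurable LZ.
  have mu n := adapted_measurable (au n).
  split.
    have [] // := @dominated_cvg_Rintegral _ _ _ P (fun n w => Z w * u n w)
      (fun w => Z w * U w) (fun w => M * `|Z w|).
    - by move=> n; exact: measurable_funM.
    - by move=> w; apply: cvgM; [exact: cvg_cst|exact: uU].
    - by apply: L1_Zl; exact: L1_norm.
    - by move=> n w; rewrite normrM mulrC ler_wpM2r.
  move=> V c' lV.
  have ms : measurable_fun setT (fun w => sin (V w + c')).
    by apply: measurable_sin_comp; apply: measurable_funD => //; exact: lin_measurable.
  have [|||| _ c1] := @dominated_cvg_Rintegral _ _ _ P
      (fun n w => Z w * u n w * sin (V w + c'))
      (fun w => Z w * U w * sin (V w + c')) (fun w => M * `|Z w|).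
  - by move=> n; apply: measurable_funM => //; exact: measurable_funM.
  - move=> w; apply: cvgM; last exact: cvg_cst.
    by apply: cvgM; [exact: cvg_cst|exact: uU].
  - by apply: L1_Zl; exact: L1_norm.
  - move=> n w; rewrite !normrM (mulrC M).
    apply: (@le_trans _ _ (`|Z w| * `|u n w|)); last by rewrite ler_wpM2l.
    by rewrite ler_piMr ?sin_max// mulr_ge0.
  have c2 : \int[P]_w (Z w * u n w * sin (V w + c')) @[n --> \oo] --> (0 : R).
    apply: cvg_near_cst; apply: nearW => n.
    by have [_ ->] := Hu n _ HZ.
  exact: (cvg_unique _ c1 c2).
Qed.

Lemma adapted_orthogonal Z U : trig_orthogonal F Z -> adapted F U ->
  \int[P]_w (Z w * U w) = 0.
Proof.
move=> HZ aU; have [_ /(_ _ (pi / 2) (lin0 F)) H] := adapted_preserves HZ aU.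
rewrite -[RHS]H; apply: eq_Rintegral => w _.
by rewrite /= add0r sin_pihalf mulr1.
Qed.

End adapted.

(** * Survival in an interval as a function of the past *)

Section sign_iteration.
Context {R : realType}.
Implicit Types (u v : R) (n : nat).

(** A polynomial whose iterates approximate the sign function on [[-1, 1]]. *)
Definition sg_step u : R := (3 * u - u ^+ 3) / 2.

Lemma sg_step_le1 u : `|u| <= 1 -> `|sg_step u| <= 1.
Proof.
rewrite !ler_norml => /andP[u1 u2]; rewrite /sg_step.
have := sqr_ge0 (u - 1); have := sqr_ge0 (u + 1).
by move=> h1 h2; apply/andP; split; nra.
Qed.

Lemma iter_sg_step_le1 n u : `|u| <= 1 -> `|iter n sg_step u| <= 1.
Proof. by move=> u1; elim: n => //= n IH; exact: sg_step_le1. Qed.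

Lemma iter_sg_stepN n u : iter n sg_step (- u) = - iter n sg_step u.
Proof. by elim: n => //= n ->; rewrite /sg_step; ring. Qed.

Lemma iter_sg_step_pos u n : 0 < u -> u <= 1 ->
  u <= iter n sg_step u <= 1 /\ 1 - iter n sg_step u <= (1 - u / 2) ^+ n.
Proof.
move=> u0 u1; elim: n => [|n [/andP[IH1 IH2] IH3]]; first by rewrite /= lexx u1 expr0; split => //; lra.
rewrite /= exprS; set v := iter n sg_step u in IH1 IH2 IH3 *.
have h1 : v <= sg_step v.
  rewrite /sg_step.
  have : 0 <= v * (1 - v) * (1 + v) by rewrite !mulr_ge0; lra.
  by nra.
have E : 1 - sg_step v = (1 - v) * ((2 - v - v ^+ 2) / 2) by rewrite /sg_step; field.
split.
  rewrite (le_trans IH1 h1)/= -subr_ge0 E mulr_ge0 ?divr_ge0//; nra.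
rewrite E mulrC; apply: ler_pM => //; nra.
Qed.

(** The iterates are polynomials bounded by 1 on [[-1, 1]]; the fixed points
    1 and -1 attract and 0 repels. *)
Lemma cvg_iter_sg_step u : `|u| <= 1 ->
  iter n sg_step u @[n --> \oo] --> Num.sg u.
Proof.
have pos v : 0 < v -> v <= 1 -> iter n sg_step v @[n --> \oo] --> (1 : R).
  move=> v0 v1.
  have c : (1 - v / 2) ^+ n @[n --> \oo] --> (0 : R).
    by apply: cvg_expr; rewrite ger0_norm; lra.
  apply/cvgrPdist_le => e e0; near=> n.
  have [/andP[_ h1] h2] := iter_sg_step_pos n v0 v1.
  rewrite ger0_norm ?subr_ge0//; apply: le_trans h2 _.
  near: n; move/cvgrPdist_le : c => /(_ _ e0); apply: filterS => n.
  by rewrite sub0r normrN; apply: le_trans; rewrite ler_norm.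
rewrite ler_norml => /andP[u1 u2].
have [u0|u0|->] := ltgtP u 0.
- rewrite ltr0_sg//.
  have -> : (fun n => iter n sg_step u) = (fun n => - iter n sg_step (- u)).
    by apply/funext => n; rewrite iter_sg_stepN opprK.
  by apply: cvgN; apply: pos; lra.
- by rewrite gtr0_sg//; exact: pos.
- rewrite sgr0; apply: cvg_near_cst; apply: nearW => n.
  by elim: n => //= n ->; rewrite /sg_step; ring.
Unshelve. all: end_near. Qed.

End sign_iteration.

Section adapted_events.
Context d (Om : measurableType d) (R : realType).
Variable F : set (Om -> R).

Lemma adapted_scale c U : adapted F U -> adapted F (fun w => c * U w).
Proof. by move=> aU; apply: adapted_mul aU; exact: adapted_cst. Qed.

Lemma adapted_sub U V : adapted F U -> adapted F V -> adapted F (fun w => U w - V w).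
Proof.
move=> aU aV; under eq_fun do rewrite -[X in _ + X]mulN1r.
by apply: adapted_add => //; exact: adapted_scale.
Qed.

Lemma adapted_iter n U : adapted F U -> adapted F (fun w => iter n sg_step (U w)).
Proof.
move=> aU; elim: n => //= n IH.
rewrite /sg_step; under eq_fun do rewrite mulrC exprS expr2.
apply: adapted_scale; apply: adapted_sub; first exact: adapted_scale.
by apply: adapted_mul => //; exact: adapted_mul.
Qed.

(** A sine only sees its argument modulo 2 pi, but the sign of
    sin ((f w - a) / k) is that of f w - a as soon as k exceeds |f w - a| / pi. *)
Lemma adapted_sgr f a : F f -> adapted F (fun w => Num.sg (f w - a)).
Proof.
move=> Ff.
pose u (k : nat) w := sin ((f w - a) / k.+1%:R).
have au k : adapted F (fun w => Num.sg (u k w)).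
  apply: (@adapted_lim _ _ _ _ 1 (fun n w => iter n sg_step (u k w))).
  - move=> n; apply: adapted_iter; rewrite /u.
    under eq_fun do rewrite mulrBl mulrC.
    exact: adapted_sin.
  - by move=> n w; apply: iter_sg_step_le1; exact: sin_max.
  - by move=> w; apply: cvg_iter_sg_step; exact: sin_max.
apply: (adapted_lim (M := 1) au).
  by move=> n w; rewrite normr_sg; case: eqP.
move=> w; apply: cvg_near_cst; rewrite /u; set v := f w - a.
exists (Num.truncn `|v|).+1 => // k /= kv.
have k0 : 0 < k.+1%:R :> R by rewrite ltr0n.
have vk : `|v / k.+1%:R| < pi.
  rewrite normf_div (ger0_norm (ltW k0)) ltr_pdivrMr//.
  apply: (@lt_trans _ _ k.+1%:R).
    by rewrite (lt_le_trans (truncnS_gt _))// ler_nat ltnW.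
  by rewrite ltr_pMl// (lt_le_trans _ (pi_ge2 R)) ?ltr1n.
have pos z : 0 < z -> `|z| < pi -> Num.sg (sin z) = 1.
  by move=> z0 zpi; rewrite gtr0_sg// sin_gt0_pi// z0 -(gtr0_norm z0).
have [v0|v0|->] := ltgtP v 0.
- rewrite (ltr0_sg v0) -[v / _]opprK sinN sgrN pos ?normrN//.
  by rewrite oppr_gt0 pmulr_llt0// invr_gt0.
- by rewrite (gtr0_sg v0) pos// divr_gt0.
- by rewrite mul0r sin0.
Qed.

Lemma adapted_gt f a : F f -> adapted F (fun w => (a < f w)%R%:R).
Proof.
move=> Ff; have as_ := adapted_sgr a Ff.
have -> : (fun w => (a < f w)%R%:R) =
    (fun w => 2^-1 * (Num.sg (f w - a) * Num.sg (f w - a) + Num.sg (f w - a))).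
  apply/funext => w; rewrite -subr_gt0; case: (sgrP (f w - a)) => _ /=; lra.
by apply: adapted_scale; apply: adapted_add => //; exact: adapted_mul.
Qed.

Lemma adapted_lt f a : F f -> adapted F (fun w => (f w < a)%R%:R).
Proof.
move=> Ff; have as_ := adapted_sgr a Ff.
have -> : (fun w => (f w < a)%R%:R) =
    (fun w => 2^-1 * (Num.sg (f w - a) * Num.sg (f w - a) - Num.sg (f w - a))).
  apply/funext => w; rewrite -subr_lt0; case: (sgrP (f w - a)) => _ /=; lra.
by apply: adapted_scale; apply: adapted_sub => //; exact: adapted_mul.
Qed.

Lemma adapted_segment f a b : F f -> adapted F (fun w => (a <= f w <= b)%R%:R).
Proof.
move=> Ff.
have -> : (fun w => (a <= f w <= b)%R%:R : R) =
    (fun w => (1 - (f w < a)%R%:R) * (1 - (b < f w)%R%:R)).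
  apply/funext => w; rewrite !leNgt.
  by case: (f w < a); case: (b < f w) => /=; rewrite ?subr0 ?subrr ?mulr0 ?mul0r ?mulr1.
apply: adapted_mul; apply: adapted_sub; try exact: adapted_cst.
- exact: adapted_lt.
- exact: adapted_gt.
Qed.

End adapted_events.

Section unit_rationals.
Context {R : realType}.

Let ratr_le1 (r : rat) : (ratr r <= 1 :> R) = (r <= 1).
Proof. by rewrite -(rmorph1 (@ratr R)) ler_rat. Qed.

Definition unit_rational (n : nat) : R :=
  if (unpickle n : option rat) is Some r then (if 0 <= r <= 1 then ratr r else 0) else 0.

Lemma unit_rational_itv n : 0 <= unit_rational n <= 1.
Proof.
rewrite /unit_rational; case: unpickle => [r|]; last by rewrite lexx ler01.
by case: ifP => [|_]; rewrite ?lexx ?ler01// ler0q ratr_le1.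
Qed.

Lemma unit_rational_dense (x e : R) : 0 <= x <= 1 -> 0 < e ->
  exists n, `|x - unit_rational n| < e.
Proof.
move=> /andP[x0 x1] e0.
have lt : Num.max 0 (x - e) < Num.min 1 (x + e).
  by rewrite lt_min !gt_max; lra.
have [r] := rat_in_itvoo lt.
rewrite in_itv/= gt_max lt_min => /andP[/andP[r0 rx] /andP[r1 xr]].
exists (pickle r); rewrite /unit_rational pickleK.
have -> : (0 <= r <= 1)%R.
  by rewrite -(ler0q R) -ratr_le1 !ltW.
by rewrite ltr_norml; lra.
Qed.

End unit_rationals.

Section within_segment.
Context {R : realType}.

Lemma within_segment_dist (T : R) (f : R -> R) (s e : R) :
  {within `[0, T], continuous f} -> 0 <= s <= T -> 0 < e ->
  exists2 r, 0 < r & forall u, 0 <= u <= T -> `|s - u| < r -> `|f s - f u| < e.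
Proof.
move=> cf sT e0.
have := (subspace_continuousP _ _).1 cf s.
rewrite /= in_itv/= => /(_ sT)/cvgrPdist_lt/(_ _ e0).
case=> r r0 H; exists r => // u uT su.
by apply: H => //=; rewrite in_itv.
Qed.

End within_segment.

Section survival.
Context d (Om : measurableType d) (R : realType) (B : R -> Om -> R) (T : R).
Hypothesis cB : forall w, {within `[0, T], continuous (fun t => B t w)}.

Definition past (t : R) : set (Om -> R) := [set f | exists2 s, 0 <= s <= t & f = B s].

Definition survives (a b t : R) (w : Om) : bool :=
  `[< forall s, 0 <= s <= t -> a < B s w < b >].

Let stays (a b t : R) (w : Om) : bool :=
  `[< forall s, 0 <= s <= t -> a <= B s w <= b >].

(* By continuity the closed condition needs to be checked on a dense sequence
   of times only. *)
Let stays_countable (a b t : R) w : 0 <= t <= T ->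
  (forall n, a <= B (t * unit_rational n) w <= b) -> stays a b t w.
Proof.
move=> /andP[t0 tT] H; apply/asboolP => s /andP[s0 st].
have sT : 0 <= s <= T by rewrite s0 (le_trans st).
have near_s e : 0 < e -> exists n, `|B s w - B (t * unit_rational n) w| < e.
  move=> e0; have [r r0 Hr] := within_segment_dist (@cB w) sT e0.
  have [t00|t0'] := leP t 0.
    exists 0%N; have -> : t = 0 by apply/le_anti/andP.
    by rewrite mul0r (_ : s = 0) ?subrr ?normr0//; apply/le_anti; rewrite s0 (le_trans st).
  have st1 : 0 <= s / t <= 1 by rewrite divr_ge0// ler_pdivrMr// mul1r.
  have [n Hn] := unit_rational_dense st1 (divr_gt0 r0 t0').
  have /andP[q0 q1] := @unit_rational_itv R n.
  exists n; apply: Hr.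
    by rewrite mulr_ge0//= (le_trans _ tT)// ler_piMr.
  rewrite (_ : s - t * unit_rational n = t * (s / t - unit_rational n)); last first.
    by field; rewrite gt_eqF.
  by rewrite normrM (gtr0_norm t0') mulrC -ltr_pdivlMr.
apply/andP; split; rewrite leNgt; apply/negP => h.
- have [|n] := near_s (a - B s w); first by rewrite subr_gt0.
  by have /andP[h1 _] := H n; rewrite ltr_norml; lra.
- have [|n] := near_s (B s w - b); first by rewrite subr_gt0.
  by have /andP[_ h1] := H n; rewrite ltr_norml; lra.
Qed.

Let adapted_stays (a b t : R) : 0 <= t <= T ->
  adapted (past t) (fun w => (stays a b t w)%:R).
Proof.
move=> tT; have /andP[t0 _] := tT.
pose p n : R := t * unit_rational n.
have pt n : past t (B (p n)).
  have /andP[q0 q1] := @unit_rational_itv R n.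
  by exists (p n) => //; rewrite mulr_ge0//= ler_piMr.
pose u N w : R := \prod_(n < N) (a <= B (p n) w <= b)%R%:R.
apply: (@adapted_lim _ _ _ _ 1 u).
- elim=> [|N IH].
    by rewrite /u; under eq_fun do rewrite big_ord0; exact: adapted_cst.
  rewrite /u; under eq_fun do rewrite big_ord_recr /=.
  by apply: adapted_mul => //; exact: adapted_segment.
- move=> N w; rewrite /u normr_prod; apply: prodr_ile1 => i _.
  by rewrite normr_ge0 normr_nat /=; case: (_ <= _ <= _).
- move=> w; apply: cvg_near_cst.
  case: (boolP (stays a b t w)) => [/asboolP sw|nsw].
    apply: nearW => N; rewrite /u big1// => i _.
    have [s st E] := pt i.
    have /andP[q0 q1] := @unit_rational_itv R i.
    by rewrite sw// mulr_ge0//= ler_piMr.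
  have [n Hn] : exists n, ~~ (a <= B (p n) w <= b).
    apply: contrapT => H; move/negP: nsw; apply; apply: stays_countable => // n.
    by apply/negPn/negP => ?; apply: H; exists n.
  exists n.+1 => // N /= nN; apply/eqP.
  by rewrite /u; apply/prodf_eq0; exists (Ordinal nN) => //=; rewrite (negbTE Hn).
Qed.

(** Survival in the open interval on the compact [[0, t]] is survival in one of the
    closed intervals [[a + 1 / k, b - 1 / k]], since the path attains its extrema
    there; survival in a closed interval is a countable intersection. *)
Lemma adapted_survives (a b t : R) : 0 <= t <= T ->
  adapted (past t) (fun w => (survives a b t w)%:R).
Proof.
move=> tT; have /andP[t0 tT'] := tT.
apply: (@adapted_lim _ _ _ _ 1
  (fun k w => (stays (a + k.+1%:R^-1) (b - k.+1%:R^-1) t w)%:R)).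
- by move=> k; exact: adapted_stays.
- by move=> k w; rewrite normr_nat; case: (stays _ _ _ _).
move=> w; apply: cvg_near_cst.
have k0 k : 0 < k.+1%:R^-1 :> R by rewrite invr_gt0 ltr0n.
case: (boolP (survives a b t w)) => [/asboolP sw|/asboolP nsw].
  have cBt : {within `[0, t], continuous (fun s => B s w)}.
    by apply: continuous_subspaceW (@cB w); apply: subset_itvl; rewrite bnd_simp.
  have [c + Hc] := EVT_min t0 cBt; rewrite in_itv /= => ct.
  have [e + He] := EVT_max t0 cBt; rewrite in_itv /= => et.
  have /andP[ac _] := sw _ ct; have /andP[_ eb] := sw _ et.
  pose m := Num.min (B c w - a) (b - B e w).
  have m0 : 0 < m by rewrite lt_min !subr_gt0 ac.
  exists (Num.truncn m^-1) => // k /= mk.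
  have km : k.+1%:R^-1 <= m.
    rewrite -[leRHS]invrK lef_pV2 ?posrE ?invr_gt0 ?ltr0n//.
    by rewrite ltW// (lt_le_trans (truncnS_gt _))// ler_nat.
  suff -> : stays (a + k.+1%:R^-1) (b - k.+1%:R^-1) t w by [].
  apply/asboolP => s st.
  have := Hc s; have := He s; rewrite !in_itv /= st => /(_ isT) h1 /(_ isT) h2.
  move: km h1 h2; rewrite le_min => /andP[]; set i := k.+1%:R^-1 => k1 k2 h1 h2.
  by apply/andP; split; lra.
apply: nearW => k; suff -> : stays (a + k.+1%:R^-1) (b - k.+1%:R^-1) t w = false by [].
apply/negP => /asboolP H; apply: nsw => s st.
have := k0 k; move: (H s st); set i := k.+1%:R^-1; move=> /andP[h1 h2] h3.
by apply/andP; split; lra.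
Qed.

End survival.

(** * Independence from uncorrelated pasts in a Gaussian family *)

Section sine_near_zero.
Context {R : realType}.
Implicit Types x z : R.

Lemma sin_mean_value z : exists2 c, `|c| <= `|z| & sin z = z * cos c.
Proof.
have pos x : 0 <= x -> exists2 c, `|c| <= `|x| & sin x = x * cos c.
  move=> x0; have [|c] := @MVT_segment R sin cos 0 x x0.
    by apply: continuous_subspaceT; exact: continuous_sin.
  rewrite in_itv/= => /andP[c0 cx]; rewrite sin0 !subr0 mulrC => E; exists c => //.
  by rewrite !ger0_norm.
have [z0|z0] := leP 0 z; first exact: pos.
have [|c cz E] := pos (- z); first by rewrite oppr_ge0 ltW.
by exists c; [rewrite -(normrN z)|rewrite -[LHS]opprK -sinN E mulNr opprK].
Qed.

(** A bounded trigonometric substitute for x, dominated by |x|. *)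
Definition sin_approx (k : nat) x : R := k.+1%:R * sin (x / k.+1%:R).

Lemma sin_approx_le k x : `|sin_approx k x| <= `|x|.
Proof.
have k0 : 0 < k.+1%:R :> R by rewrite ltr0n.
rewrite /sin_approx; have [c _ ->] := sin_mean_value (x / k.+1%:R).
have -> : k.+1%:R * (x / k.+1%:R * cos c) = x * cos c by field; rewrite gt_eqF.
by rewrite normrM ler_piMr// cos_max.
Qed.

Lemma cvg_sin_approx x : sin_approx k x @[k --> \oo] --> x.
Proof.
have cc : cos (z : R) @[z --> (0 : R)] --> (1 : R).
  by rewrite -[X in _ --> X](@cos0 R); exact: continuous_cos.
apply/cvgrPdist_le => e e0.
have e1 : 0 < e / (1 + `|x|) by rewrite divr_gt0// ltr_wpDr.
move/cvgrPdist_le : cc => /(_ _ e1)[r r0 Hr].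
exists (Num.truncn (`|x| / r)).+1 => // k /= kx.
have k0 : 0 < k.+1%:R :> R by rewrite ltr0n.
rewrite /sin_approx; have [c cz ->] := sin_mean_value (x / k.+1%:R).
have -> : k.+1%:R * (x / k.+1%:R * cos c) = x * cos c by field; rewrite gt_eqF.
have /Hr : ball_ Num.norm 0 r c.
  rewrite /ball_ /= sub0r normrN (le_lt_trans cz)//.
  rewrite normf_div (gtr0_norm k0) ltr_pdivrMr// mulrC -ltr_pdivrMr//.
  by rewrite (lt_le_trans (truncnS_gt _))// ler_nat ltnW.
rewrite /= => H; have -> : x - x * cos c = x * (1 - cos c) by ring.
rewrite normrM (le_trans (ler_wpM2l (normr_ge0 x) H))//.
rewrite mulrCA; apply: ler_piMr; first exact: ltW.
by rewrite ler_pdivrMr ?mul1r ?lerDr// ltr_wpDr.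
Qed.

End sine_near_zero.

Section moments.
Context d (Om : measurableType d) (R : realType) (P : probability Om R).
Local Notation L1 f := (P.-integrable setT (EFin \o f)).
Implicit Types X Y : Om -> R.

Lemma L1_cst (c : R) : L1 (cst c).
Proof. exact: finite_measure_integrable_cst. Qed.

Lemma Rintegral_cst_prob (c : R) : \int[P]_w c = c.
Proof.
rewrite Rintegral_cst// -[RHS]mulr1; congr (_ * _).
by rewrite -[RHS]/(fine 1%E); congr fine; exact: probability_setT.
Qed.

Lemma L4_L2 X : measurable_fun setT X -> L1 (fun w => X w ^+ 4) -> L1 (fun w => X w ^+ 2).
Proof.
move=> mX LX; apply: (@L1_le _ _ _ _ _ (fun w => 1 + X w ^+ 4)).
- exact: measurable_funX.
- by apply: L1_D => //; exact: L1_cst.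
- move=> w; rewrite ger0_norm ?sqr_ge0//.
  have -> : X w ^+ 4 = (X w ^+ 2) ^+ 2 by rewrite -exprM.
  by have := sqr_ge0 (X w ^+ 2 - 1); have := sqr_ge0 (X w ^+ 2); nra.
Qed.

Lemma L2_M X Y : measurable_fun setT X -> measurable_fun setT Y ->
  L1 (fun w => X w ^+ 2) -> L1 (fun w => Y w ^+ 2) -> L1 (fun w => X w * Y w).
Proof.
move=> mX mY LX LY; apply: (@L1_le _ _ _ _ _ (fun w => X w ^+ 2 + Y w ^+ 2)).
- exact: measurable_funM.
- exact: L1_D.
- move=> w; rewrite ler_norml.
  have := sqr_ge0 (X w - Y w); have := sqr_ge0 (X w + Y w).
  by move=> h1 h2; apply/andP; split; have := sqr_ge0 (X w); have := sqr_ge0 (Y w); nra.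
Qed.

Lemma L2_L1 X : measurable_fun setT X -> L1 (fun w => X w ^+ 2) -> L1 X.
Proof.
move=> mX LX; have := L2_M mX (measurable_cst (1 : R)) LX (L1_cst (1 ^+ 2)).
by under eq_fun do rewrite mulr1.
Qed.

Lemma gaussian_with_mean X m v : gaussian_with P X m v -> L1 X /\ \int[P]_w X w = m.
Proof.
move=> gX; have mX := gaussian_measurable gX.
have mXm : measurable_fun setT (fun w => X w - m) by exact: measurable_funB.
have LXm : L1 (fun w => X w - m) by exact: L2_L1 (L4_L2 mXm (gaussian_L4 gX)).
have E : X = (fun w => (X w - m) + m) by apply/funext => w; rewrite subrK.
have LX : L1 X by rewrite E; apply: L1_D => //; exact: L1_cst.
split => //; have := gaussian_mean gX.
rewrite RintegralB//; last exact: L1_cst.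
by rewrite Rintegral_cst_prob => /eqP; rewrite subr_eq0 => /eqP.
Qed.

End moments.

Section gaussian_family.
Context d (Om : measurableType d) (R : realType) (P : probability Om R).
Local Notation L1 f := (P.-integrable setT (EFin \o f)).
Implicit Types (V W L : Om -> R).

Definition centered V w := V w - \int[P]_w V w.

Lemma lin_sub (F G : set (Om -> R)) V : F `<=` G -> lin F V -> lin G V.
Proof.
by move=> FG; elim=> [|a f {}V Ff _ IH]; [exact: lin0|apply: linD => //; exact: FG].
Qed.

Lemma lin_scaleD (F : set (Om -> R)) a V W : lin F V -> lin F W ->
  lin F (fun w => a * V w + W w).
Proof.
move=> lV lW; elim: lV => [|b f {}V Ff _ IH].
  by under eq_fun do rewrite mulr0 add0r.
by under eq_fun do rewrite mulrDr mulrA -addrA; exact: linD.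
Qed.

Variable G : set (Om -> R).
Hypothesis gG : forall V, lin G V -> gaussian_rv P V.

Lemma lin_gaussian V : lin G V ->
  gaussian_with P V (\int[P]_w V w) (\int[P]_w (centered V w ^+ 2)).
Proof.
move=> /gG/gaussian_rvP[m [v gV]].
have [_ Em] := gaussian_with_mean gV; have Ev := gaussian_var gV.
by rewrite /centered Em Ev.
Qed.

Lemma lin_L1 V : lin G V -> L1 V.
Proof. by move=> /lin_gaussian/gaussian_with_mean[]. Qed.

Lemma centered_measurable V : lin G V -> measurable_fun setT (centered V).
Proof.
by move=> /lin_gaussian gV; apply: measurable_funB => //; exact: gaussian_measurable gV.
Qed.

Lemma centered_L2 V : lin G V -> L1 (fun w => centered V w ^+ 2).
Proof.
move=> lV; apply: L4_L2; first exact: centered_measurable.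
exact: gaussian_L4 (lin_gaussian lV).
Qed.

Lemma centered_L1 V : lin G V -> L1 (centered V).
Proof. by move=> lV; apply: L2_L1; [exact: centered_measurable|exact: centered_L2]. Qed.

Lemma centered_scaleD a V W : lin G V -> lin G W ->
  centered (fun w => a * V w + W w) = (fun w => a * centered V w + centered W w).
Proof.
move=> lV lW; apply/funext => w; rewrite /centered.
rewrite RintegralD//; [|by apply: L1_Zl; exact: lin_L1|exact: lin_L1].
rewrite RintegralZl//; last exact: lin_L1.
by ring.
Qed.

Lemma lin_uncorrelated (F : set (Om -> R)) L V : F `<=` G -> lin G L ->
  (forall f, F f -> \int[P]_w (centered L w * centered f w) = 0) ->
  lin F V -> \int[P]_w (centered L w * centered V w) = 0.
Proof.
move=> FG lL H; elim=> [|a f {}V Ff lV IH].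
  rewrite /centered Rintegral_cst_prob; under eq_Rintegral do rewrite /= subrr mulr0.
  exact: Rintegral_cst_prob.
have lf : lin G f.
  have := linD 1 (FG _ Ff) (lin0 G).
  by under eq_fun do rewrite /= mul1r addr0.
have lV' := lin_sub FG lV.
have LM W : lin G W -> L1 (fun w => centered L w * centered W w).
  move=> lW; apply: L2_M; try exact: centered_measurable; exact: centered_L2.
rewrite centered_scaleD//; under eq_Rintegral do rewrite mulrDr mulrCA.
rewrite RintegralD//; [|by apply: L1_Zl; exact: LM|exact: LM].
rewrite RintegralZl//; last exact: LM.
by rewrite (H _ Ff) IH mulr0 addr0.
Qed.

Section innovation.
Variables (F : set (Om -> R)) (L : Om -> R).
Hypotheses (FG : F `<=` G) (lL : lin G L).
Hypothesis unc : forall f, F f -> \int[P]_w (centered L w * centered f w) = 0.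
Let X := centered L.
Let s2 := \int[P]_w (X w ^+ 2).

(* The variances add because X is uncorrelated with V, so that the
   characteristic function of the pair factorizes. *)
Let char V (t c : R) : lin F V -> \int[P]_w cos (t * X w + centered V w + c) =
  expR (- ((t ^+ 2 * s2 + \int[P]_w (centered V w ^+ 2)) / 2)) * cos c.
Proof.
move=> lV; have lV' := lin_sub FG lV.
have lW := lin_scaleD t lL lV'.
have := gaussian_cos (lin_gaussian lW) c.
rewrite -/(centered (fun w => t * L w + V w)).
have LX2 := centered_L2 lL; have LV2 := centered_L2 lV'.
have -> : \int[P]_w (centered (fun w => t * L w + V w) w ^+ 2) =
    t ^+ 2 * s2 + \int[P]_w (centered V w ^+ 2).
  rewrite centered_scaleD//.
  transitivity (\int[P]_w ((t ^+ 2 * X w ^+ 2 + 2 * t * (X w * centered V w)) + centered V w ^+ 2)).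
    by apply: eq_Rintegral => w _; rewrite /X; ring.
  have LXV : L1 (fun w => X w * centered V w).
    by apply: L2_M => //; exact: centered_measurable.
  rewrite RintegralD//; last by apply: L1_D; exact: L1_Zl.
  rewrite RintegralD//; [|exact: L1_Zl|exact: L1_Zl].
  by rewrite !RintegralZl// (lin_uncorrelated FG lL unc lV) mulr0 addr0.
move=> <-; apply: eq_Rintegral => w _; congr (cos (_ + c)).
by rewrite -[RHS]/(centered (fun w => t * L w + V w) w) centered_scaleD.
Qed.

Let mX : measurable_fun setT X. Proof. exact: centered_measurable. Qed.

Let measurable_cos_comp V : measurable_fun setT V ->
  measurable_fun setT (fun w => cos (V w)).
Proof.
move=> mV; apply: measurableT_comp => //.
by apply: continuous_measurable_fun; exact: continuous_cos.
Qed.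

Let L1_bounded V : measurable_fun setT V -> (forall w, `|V w| <= 1) -> L1 V.
Proof. by move=> mV V1; apply: L1_le mV (L1_cst P 1) V1. Qed.

Let charD V t c : lin F V ->
  \int[P]_w (cos (t * X w) * cos (centered V w + c)) =
  expR (- (t ^+ 2 * s2 / 2)) * \int[P]_w cos (centered V w + c).
Proof.
move=> lV; have mV := centered_measurable (lin_sub FG lV).
have Lc b : L1 (fun w => cos (b * X w + centered V w + c)).
  apply: L1_bounded; last by move=> w; exact: cos_max.
  apply: measurable_cos_comp; apply: measurable_funD => //; apply: measurable_funD => //.
  exact: measurable_funM.
transitivity (2^-1 * (\int[P]_w cos (t * X w + centered V w + c) +
    \int[P]_w cos (- t * X w + centered V w + c))).
  rewrite -RintegralD// -RintegralZl//; last exact: L1_D.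
  apply: eq_Rintegral => w _.
  rewrite -!addrA (cosD (t * X w)) mulNr [X in _ = _ * (_ + cos X)]addrC cosB.
  by field.
have E0 : \int[P]_w cos (centered V w + c) =
    expR (- (\int[P]_w (centered V w ^+ 2) / 2)) * cos c.
  have := char 0 c lV; rewrite expr0n/= mul0r add0r => <-.
  by apply: eq_Rintegral => w _; rewrite mul0r add0r.
rewrite E0 (char t c lV) (char (- t) c lV) sqrrN mulrDl opprD expRD.
set p := expR _; set q := expR _; by field.
Qed.

Let charS V t c : lin F V ->
  \int[P]_w (sin (t * X w) * sin (centered V w + c)) = 0.
Proof.
move=> lV; have mV := centered_measurable (lin_sub FG lV).
have Lc b : L1 (fun w => cos (b * X w + centered V w + c)).
  apply: L1_bounded; last by move=> w; exact: cos_max.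
  apply: measurable_cos_comp; apply: measurable_funD => //; apply: measurable_funD => //.
  exact: measurable_funM.
transitivity (2^-1 * (\int[P]_w cos (- t * X w + centered V w + c) -
    \int[P]_w cos (t * X w + centered V w + c))).
  rewrite -RintegralB// -RintegralZl//; last exact: L1_B.
  apply: eq_Rintegral => w _.
  rewrite -!addrA (cosD (t * X w)) mulNr [X in _ = _ * (cos X - _)]addrC cosB.
  by field.
by rewrite (char t c lV) (char (- t) c lV) sqrrN subrr mulr0.
Qed.

(** Since E [sin (t X) sin (V + c)] = 0, the limit of its quotient by t as t -> 0
    vanishes as well. *)
Lemma innovation_orthogonal : trig_orthogonal P F X.
Proof.
have LX := centered_L1 lL.
split => // V c lV; have mV := centered_measurable (lin_sub FG lV).
pose e := \int[P]_w V w + c.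
have Ve w : V w + c = centered V w + e by rewrite /centered /e; ring.
under eq_Rintegral do rewrite Ve.
have ms : measurable_fun setT (fun w => sin (centered V w + e)).
  by apply: measurable_sin_comp; exact: measurable_funD.
have [|||| _ c1] := @dominated_cvg_Rintegral _ _ _ P
  (fun k w => sin_approx k (X w) * sin (centered V w + e))
  (fun w => X w * sin (centered V w + e)) (fun w => `|X w|).
- move=> k; apply: measurable_funM => //; rewrite /sin_approx.
  apply: measurable_funM => //; apply: measurable_sin_comp.
  exact: measurable_funM.
- by move=> w; apply: cvgM; [exact: cvg_sin_approx|exact: cvg_cst].
- exact: L1_norm.
- move=> k w; rewrite normrM -[leRHS]mulr1.
  by apply: ler_pM => //; [exact: sin_approx_le|exact: sin_max].
have c2 : \int[P]_w (sin_approx k (X w) * sin (centered V w + e)) @[k --> \oo] --> (0 : R).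
  apply: cvg_near_cst; apply: nearW => k.
  transitivity (k.+1%:R * \int[P]_w (sin (k.+1%:R^-1 * X w) * sin (centered V w + e))).
    rewrite -RintegralZl//.
      by apply: eq_Rintegral => w _; rewrite /sin_approx mulrA [X in sin X]mulrC.
    apply: L1_bounded.
      apply: measurable_funM => //; apply: measurable_sin_comp; exact: measurable_funM.
    by move=> w; rewrite normrM mulr_ile1// sin_max.
  by rewrite charS// mulr0.
exact: (cvg_unique _ c1 c2).
Qed.

(** The quantity k^2 sin^2 (X / k) tends to X^2, and its product with
    cos (V + e) has mean a_k E [cos (V + e)], where a_k depends on the variance s2
    of X only.  The value of lim a_k comes for free from the case V = 0: it is
    E [X^2] = s2. *)
Lemma innovation_sqr_orthogonal : trig_orthogonal P F (fun w => X w ^+ 2 - s2).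
Proof.
have LX2 := centered_L2 lL.
split; first by apply: L1_B => //; exact: L1_cst.
move=> V c lV; have mV := centered_measurable (lin_sub FG lV).
(* The shift by pi / 2 turns the sine into a cosine. *)
pose e := \int[P]_w V w + c - pi / 2.
have Ve w : sin (V w + c) = cos (centered V w + e).
  by rewrite -sinDpihalf; congr sin; rewrite /centered /e; ring.
under eq_Rintegral do rewrite Ve.
pose a k : R := k.+1%:R ^+ 2 / 2 * (1 - expR (- ((2 / k.+1%:R) ^+ 2 * s2 / 2))).
have lim W f : lin F W -> (a k * \int[P]_w cos (centered W w + f)) @[k --> \oo] -->
    \int[P]_w (X w ^+ 2 * cos (centered W w + f)).
  move=> lW; have mW := centered_measurable (lin_sub FG lW).
  have mc : measurable_fun setT (fun w => cos (centered W w + f)).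
    by apply: measurable_cos_comp; exact: measurable_funD.
  have [|||| _] := @dominated_cvg_Rintegral _ _ _ P
    (fun k w => sin_approx k (X w) ^+ 2 * cos (centered W w + f))
    (fun w => X w ^+ 2 * cos (centered W w + f)) (fun w => X w ^+ 2).
  - move=> k; apply: measurable_funM => //; rewrite /sin_approx.
    apply: measurable_funX; apply: measurable_funM => //; apply: measurable_sin_comp.
    exact: measurable_funM.
  - move=> w; apply: cvgM; last exact: cvg_cst.
    by apply: cvgM; exact: cvg_sin_approx.
  - exact: LX2.
  - move=> k w; rewrite normrM -[leRHS]mulr1.
    apply: ler_pM => //; last exact: cos_max.
    by rewrite normrX -[leRHS](real_normK (num_real _)) lerXn2r ?nnegrE// sin_approx_le.
  apply: cvg_trans; apply: near_eq_cvg; apply: nearW => k.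
  have k0 : k.+1%:R != 0 :> R by rewrite pnatr_eq0.
  have Lcc b : L1 (fun w => cos (b * X w) * cos (centered W w + f)).
    apply: L1_bounded.
      apply: measurable_funM => //; apply: measurable_cos_comp; exact: measurable_funM.
    by move=> w; rewrite normrM mulr_ile1// cos_max.
  have Lc : L1 (fun w => cos (centered W w + f)).
    by apply: L1_bounded => // w; exact: cos_max.
  transitivity (k.+1%:R ^+ 2 / 2 * (\int[P]_w cos (centered W w + f) -
      \int[P]_w (cos (2 / k.+1%:R * X w) * cos (centered W w + f)))).
    rewrite -RintegralB// -RintegralZl//; last exact: L1_B.
    apply: eq_Rintegral => w _; rewrite /sin_approx.
    have -> : 2 / k.+1%:R * X w = (X w / k.+1%:R) *+ 2 by rewrite -mulr_natl; field.
    by rewrite cos_mulr2n cos2sin2; field.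
  by rewrite charD// /a; ring.
have l0 := lim _ 0 (lin0 F).
have c0 : centered (cst 0) = cst 0 :> (Om -> R).
  by apply/funext => w; rewrite /centered Rintegral_cst_prob subrr.
have sl : a k @[k --> \oo] --> s2.
  move: l0; rewrite c0.
  under [in X in _ --> X]eq_Rintegral do rewrite /= addr0 cos0 mulr1.
  under eq_fun do under eq_Rintegral do rewrite /= addr0 cos0.
  by under eq_fun do rewrite Rintegral_cst_prob mulr1.
have Lc : L1 (fun w => cos (centered V w + e)).
  apply: L1_bounded; last by move=> w; exact: cos_max.
  by apply: measurable_cos_comp; exact: measurable_funD.
have E := cvg_unique _ (lim _ e lV) (cvgM sl (cvg_cst (\int[P]_w cos (centered V w + e)))).
under eq_Rintegral do rewrite mulrBl.
rewrite RintegralB//; last exact: L1_Zl.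
  by rewrite RintegralZl// E// subrr.
apply: L1_bounded_Mr LX2 _ _; last by move=> w; exact: cos_max.
by apply: measurable_cos_comp; exact: measurable_funD.
Qed.

End innovation.
End gaussian_family.

(** * The martingale of the Brownian bridge *)

Section bridge_martingale.
Context d (Om : measurableType d) (R : realType) (P : probability Om R).
Local Notation L1 f := (P.-integrable setT (EFin \o f)).
Variables (T y : R) (B : R -> {RV P >-> R}).
Hypotheses (T0 : 0 < T) (bB : brownian_bridge T y B).
Let b (t : R) : Om -> R := B t.

Lemma past_measurable t f : past b t f -> measurable_fun setT f.
Proof. by move=> [s _ ->]; exact: measurable_funPT. Qed.

Lemma past_sub s t : s <= t -> past b s `<=` past b t.
Proof.
move=> st f [u /andP[u0 us] ->]; exists u => //; by rewrite u0 (le_trans us).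
Qed.

Lemma bridge_lin_gaussian V : lin (past b T) V -> gaussian_rv P V.
Proof.
case: bB => _ gB _ _ lV.
suff [n [c [t [tT ->]]]] : exists n (c t : 'I_n -> R), (forall i, (`[0, T]%classic : set R) (t i)) /\
    V = (fun w => \sum_(i < n) c i * B (t i) w) by exact: gB.
elim: lV => [|a f {}V [s sT ->] _ [n [c [t [tT ->]]]]].
  exists 0%N, (fun=> 0), (fun=> 0); split; first by case.
  by apply/funext => w; rewrite big_ord0.
exists n.+1, (fun i => oapp c a (unlift ord0 i)), (fun i => oapp t s (unlift ord0 i)).
split; first by move=> i; case: unlift => //=; rewrite in_itv.
apply/funext => w; rewrite big_ord_recl unlift_none /=; congr (_ + _).
by apply: eq_bigr => i _; rewrite liftK.
Qed.

Lemma past_lin t : 0 <= t <= T -> lin (past b T) (b t).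
Proof.
move=> tT; have := @linD _ _ _ (past b T) 1 (b t) _ _ (lin0 _).
under eq_fun do rewrite /= mul1r addr0.
by apply; exists t.
Qed.

Let gG := bridge_lin_gaussian.

Lemma bridge_mean t : 0 <= t <= T -> \int[P]_w b t w = y * t / T.
Proof.
move=> tT; case: bB => _ _ /(_ t) + _; rewrite in_itv/= => /(_ tT).
by rewrite unlock => E; rewrite /Rintegral E.
Qed.

Lemma bridge_centered t : 0 <= t <= T -> centered P (b t) = (fun w => b t w - y * t / T).
Proof. by move=> tT; apply/funext => w; rewrite /centered bridge_mean. Qed.

Lemma bridge_cov s t : 0 <= s <= T -> 0 <= t <= T ->
  \int[P]_w (centered P (b s) w * centered P (b t) w) = Num.min s t - s * t / T.
Proof.
move=> sT tT; case: bB => _ _ mB /(_ s t).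
rewrite !in_itv/= => /(_ sT tT).
rewrite unlock /= !mB ?in_itv//= unlock => E.
rewrite !bridge_centered// /Rintegral.
by rewrite -[RHS]/(fine (Num.min s t - s * t / T)%:E) -E.
Qed.

Definition martingale t w : R := (b t w - y * t / T) * (T / (T - t)).
(** The variance of the martingale at time [t]. *)
Definition clock (t : R) : R := t * T / (T - t).

Section increment.
Variables s t : R.
Hypotheses (s0 : 0 <= s) (st : s <= t) (tT : t < T).
Let X w := martingale t w - martingale s w.
Let L w : R := T / (T - t) * b t w + (- (T / (T - s)) * b s w + 0).

Let sT : s < T. Proof. exact: le_lt_trans tT. Qed.
Let sT' : 0 <= s <= T. Proof. by rewrite s0 ltW. Qed.
Let tT' : 0 <= t <= T. Proof. by rewrite (le_trans s0 st) ltW. Qed.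

Let lL : lin (past b T) L.
Proof.
apply: linD; first by exists t.
by apply: linD; [exists s|exact: lin0].
Qed.

Let XE : X = centered P L.
Proof.
have l0 : lin (past b T) (fun w => - (T / (T - s)) * b s w + cst 0 w).
  by apply: linD; [exists s|exact: lin0].
apply/funext => w.
rewrite /L (centered_scaleD gG _ (past_lin tT') l0).
rewrite (centered_scaleD gG _ (past_lin sT') (lin0 _)).
rewrite !bridge_centered// /centered Rintegral_cst_prob /X /martingale /=.
by ring.
Qed.

(* For u <= s both terms equal u: the increment is uncorrelated with the past
   of s. *)
Let covL u : 0 <= u <= T -> \int[P]_w (X w * centered P (b u) w) =
  T / (T - t) * (Num.min t u - t * u / T) - T / (T - s) * (Num.min s u - s * u / T).
Proof.
move=> uT.
have LM v : 0 <= v <= T -> L1 (fun w => centered P (b v) w * centered P (b u) w).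
  move=> vT; apply: L2_M.
  - by apply: centered_measurable gG _ (past_lin vT).
  - by apply: centered_measurable gG _ (past_lin uT).
  - by apply: centered_L2 gG _ (past_lin vT).
  - by apply: centered_L2 gG _ (past_lin uT).
rewrite -!bridge_cov// -!RintegralZl ?LM// -RintegralB ?L1_Zl ?LM//.
by apply: eq_Rintegral => w _; rewrite /X /martingale !bridge_centered//; ring.
Qed.

Let unc f : past b s f -> \int[P]_w (centered P L w * centered P f w) = 0.
Proof.
move=> [u /andP[u0 us] ->].
have uT : 0 <= u <= T by rewrite u0 (le_trans us)// ltW.
rewrite -XE covL// min_r ?(le_trans us)// min_r//.
by field; rewrite !gt_eqF// subr_gt0.
Qed.

Let varX : \int[P]_w (X w ^+ 2) = clock t - clock s.
Proof.
have LM v : 0 <= v <= T -> L1 (fun w => X w * centered P (b v) w).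
  move=> vT; rewrite XE; apply: L2_M.
  - by apply: centered_measurable gG _ lL.
  - by apply: centered_measurable gG _ (past_lin vT).
  - by apply: centered_L2 gG _ lL.
  - by apply: centered_L2 gG _ (past_lin vT).
transitivity (T / (T - t) * \int[P]_w (X w * centered P (b t) w) -
    T / (T - s) * \int[P]_w (X w * centered P (b s) w)).
  rewrite -!RintegralZl ?LM// -RintegralB ?L1_Zl ?LM//.
  apply: eq_Rintegral => w _; rewrite !bridge_centered// expr2 {2}/X /martingale.
  by rewrite mulrBr; congr (_ - _); ring.
rewrite !covL// !minxx (min_l st) (min_r st) /clock.
by field; rewrite !gt_eqF// subr_gt0.
Qed.

Lemma increment_orthogonal : trig_orthogonal P (past b s) X.
Proof. by rewrite XE; exact: (innovation_orthogonal gG (past_sub (ltW sT)) lL unc). Qed.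

Lemma increment_sqr_orthogonal :
  trig_orthogonal P (past b s) (fun w => X w ^+ 2 - (clock t - clock s)).
Proof.
by rewrite -varX XE; exact: (innovation_sqr_orthogonal gG (past_sub (ltW sT)) lL unc).
Qed.

Lemma increment_L4 : L1 (fun w => X w ^+ 4).
Proof. by rewrite XE; exact: gaussian_L4 (lin_gaussian gG lL). Qed.

Lemma increment_moment4 : \int[P]_w (X w ^+ 4) = 3 * (clock t - clock s) ^+ 2.
Proof. by rewrite -varX XE; exact: gaussian_moment4 (lin_gaussian gG lL). Qed.

End increment.

(** The variance t - t^2 / T vanishes at both ends. *)
Lemma bridge_endpoints : {ae P, forall w, b 0 w = 0 /\ b T w = y}.
Proof.
have pinned t : 0 <= t <= T -> t - t * t / T = 0 -> {ae P, forall w, b t w = y * t / T}.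
  move=> tT v0.
  have mc : measurable_fun setT (fun w => centered P (b t) w ^+ 2).
    by apply: measurable_funX; apply: centered_measurable gG _ (past_lin tT).
  have c2 : \int[P]_w (centered P (b t) w ^+ 2) = 0.
    under eq_Rintegral do rewrite expr2.
    by rewrite bridge_cov// minxx.
  have L2 := centered_L2 gG (past_lin tT).
  have I0 : (\int[P]_w `|(centered P (b t) w ^+ 2)%:E| = 0)%E.
    under eq_integral do rewrite gee0_abs ?lee_fin ?sqr_ge0//.
    rewrite -[LHS]fineK; last exact: integrable_fin_num.
    by congr EFin.
  have me : measurable_fun setT (fun w => (centered P (b t) w ^+ 2)%:E).
    exact/measurable_EFinP.
  have := (ae_eq_integral_abs P measurableT me).1 I0; apply: filterS => w /(_ Logic.I) /= /eqP.
  by rewrite eqe sqrf_eq0 bridge_centered// subr_eq0 => /eqP.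
have Tn : T != 0 by rewrite gt_eqF.
have := pinned 0; rewrite lexx ltW// mul0r mul0r subrr => /(_ isT erefl) h0.
have := pinned T; rewrite lexx ltW// mulfK// subrr => /(_ isT erefl) hT.
apply: filterS2 h0 hT => w -> ->.
by rewrite mulr0 mul0r mulfK.
Qed.

End bridge_martingale.

(** * Path inequalities on a grid *)

Section stopped_sequences.
Context {R : realType}.
Implicit Types (s : nat -> bool) (g : nat -> R).

Lemma antitone_threshold s N : s 0%N -> (forall i, s i.+1 -> s i) -> ~~ s N ->
  exists2 j, (0 < j <= N)%N & forall i, s i = (i < j)%N.
Proof.
move=> s0 anti sN.
have [j nsj jmin] := @ex_minnP (fun i => ~~ s i) (ex_intro _ N sN).
have j0 : (0 < j)%N by case: j nsj {jmin} => //; rewrite s0.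
exists j; first by rewrite j0 jmin.
have down i k : s (i + k)%N -> s i.
  by elim: k => [|k IH]; rewrite ?addn0// addnS => /anti.
move=> i; case: (ltnP i j) => ij.
  by apply/negPn/negP => /jmin; rewrite leqNgt ij.
by apply/negbTE/negP; rewrite -(subnKC ij) => /down; apply/negP.
Qed.

Lemma stopped_sum g j K : \sum_(i < K) ((g i.+1 - g i) * (i < j)%:R) =
  g (minn j K) - g 0%N.
Proof.
elim: K => [|K IH]; first by rewrite big_ord0 minn0 subrr.
rewrite big_ord_recr /= IH; have [Kj|jK] := boolP (K < j)%N.
  by rewrite (minn_idPr (ltnW Kj)) (minn_idPr Kj) mulr1; ring.
rewrite -leqNgt in jK.
by rewrite (minn_idPl jK) (minn_idPl (leqW jK)) mulr0 addr0.
Qed.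

Lemma last_value_sum g j N : (0 < j <= N)%N ->
  \sum_(i < N) (g i * ((i < j)%:R - (i.+1 < j)%:R)) = g j.-1.
Proof.
move=> /andP[j0 jN]; have jN' : (j.-1 < N)%N by rewrite prednK.
rewrite (bigD1 (Ordinal jN'))//= prednK// leqnn ltnn subr0 mulr1.
rewrite big1 ?addr0// => i /negbTE/eqP ij.
have -> : (i < j)%N = (i.+1 < j)%N.
  apply/idP/idP => [h|/ltnW//].
  rewrite ltn_neqAle h andbT; apply/eqP => E; apply: ij; apply/val_inj => /=.
  by rewrite -E.
by rewrite subrr mulr0.
Qed.

End stopped_sequences.

(** One path at a time: [v] and [m] are the values of the bridge and of its
    martingale at the grid times [t], [s i] says that the path has stayed in the
    interval up to time [t i], and [Q] bounds the fourth powers of the increments of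
    [m] up to time [t K] = T / q. *)
Section path_inequalities.
Context {R : realType}.
Variables (T y h e Q : R) (q K : nat).
Hypotheses (T0 : 0 < T) (h0 : 0 < h) (e0 : 0 < e) (K0 : (0 < K)%N).
Hypotheses (q2 : (2 <= q)%N) (qy : 32 * y ^+ 2 / T <= q%:R).
Let N := (q * K)%N.
Variable t : nat -> R.
Hypothesis tE : forall i, t i = i%:R * T / N%:R.
Variables (v : nat -> R) (s : nat -> bool).
Hypotheses (s0 : s 0%N) (anti : forall i, s i.+1 -> s i) (sN : ~~ s N).
Hypotheses (v0 : v 0%N = 0) (vh : forall i, s i -> `|v i| <= h).
Variable m : nat -> R.
Hypothesis mE : forall i, m i = (v i - y * t i / T) * (T / (T - t i)).
Hypothesis Qm : forall i, (i < K)%N -> (m i.+1 - m i) ^+ 4 <= Q.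

Let q0 : 0 < q%:R :> R. Proof. by rewrite ltr0n; apply: leq_trans q2. Qed.
Let KR : 0 < K%:R :> R. Proof. by rewrite ltr0n. Qed.
Let NE : N%:R = q%:R * K%:R :> R. Proof. by rewrite natrM. Qed.
Let t0 i : 0 <= t i.
Proof. by rewrite tE divr_ge0// mulr_ge0// ltW. Qed.
Let tK : t K = T / q%:R.
Proof. by rewrite tE NE; field; rewrite !gt_eqF. Qed.
Let t_le i k : (i <= k)%N -> t i <= t k.
Proof.
move=> ik; rewrite !tE ler_pM2r ?invr_gt0 ?NE ?mulr_gt0//.
by rewrite ler_pM2r// ler_nat.
Qed.
Let t_half i : (i <= K)%N -> t i <= T / 2.
Proof.
move=> iK; apply: le_trans (t_le iK) _; rewrite tK ler_pM2l// lef_pV2 ?posrE//.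
by rewrite ler_nat.
Qed.
Let Q0 : 0 <= Q.
Proof. by apply: le_trans (Qm K0); rewrite exprn_even_ge0. Qed.

(* q >= 2 keeps t i <= T / 2, so that T / (T - t i) <= 2. *)
Let m_bound i : (i <= K)%N -> s i -> `|m i| <= 2 * (h + `|y| * t i / T).
Proof.
move=> iK si; rewrite mE normrM mulrC.
have th := t_half iK; have ti := t0 i.
have T_gt0 := T0; have d0 : 0 < T - t i by lra.
apply: ler_pM => //.
  have dn : 0 <= T / (T - t i) by apply: divr_ge0; exact: ltW.
  by rewrite ger0_norm// ler_pdivrMr//; lra.
apply: le_trans (ler_normB _ _) _; rewrite lerD ?vh//.
have Ti : 0 <= T^-1 by rewrite invr_ge0 ltW.
by rewrite normrM (ger0_norm Ti) normrM (ger0_norm ti).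
Qed.

Let c := (2 * h + 2 * `|y|) / T.

Let v_m i : (i <= K)%N -> s i -> `|v i - m i| <= c * t i.
Proof.
move=> iK si; have th := t_half iK; have ti := t0 i.
have T_gt0 := T0; have h_gt0 := h0; have d0 : 0 < T - t i by lra.
have -> : v i - m i = (y - m i) * (t i / T).
  by rewrite mE; field; rewrite !gt_eqF.
have -> : c * t i = (2 * h + 2 * `|y|) * (t i / T) by rewrite /c; ring.
have tT : 0 <= t i / T by apply: divr_ge0 => //; exact: ltW.
rewrite normrM (ger0_norm tT) ler_wpM2r//.
apply: le_trans (ler_normB _ _) _.
have := m_bound iK si.
have : `|y| * t i / T <= `|y| / 2.
  rewrite -mulrA ler_wpM2l// ler_pdivrMr//; lra.
lra.
Qed.

Let small_sqr x : x ^+ 4 <= Q -> x ^+ 2 <= e ^+ 2 + Q / e ^+ 2.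
Proof.
move=> xQ; have e20 : 0 < e ^+ 2 by rewrite exprn_gt0.
have [xe|ex] := leP (x ^+ 2) (e ^+ 2).
  by rewrite (le_trans xe)// lerDl divr_ge0// ltW.
have : x ^+ 2 <= Q / e ^+ 2.
  rewrite ler_pdivlMr// (le_trans _ xQ)//.
  rewrite (_ : x ^+ 4 = x ^+ 2 * x ^+ 2); last by rewrite -exprD.
  by rewrite ler_wpM2l ?sqr_ge0// ltW.
by have := sqr_ge0 e; lra.
Qed.

Let small_norm x : x ^+ 4 <= Q -> `|x| <= e + Q / e ^+ 3.
Proof.
move=> xQ; have e30 : 0 < e ^+ 3 by rewrite exprn_gt0.
have [xe|ex] := leP `|x| e.
  by rewrite (le_trans xe)// lerDl divr_ge0// ltW.
have : `|x| <= Q / e ^+ 3.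
  rewrite ler_pdivlMr// (le_trans _ xQ)//.
  have -> : x ^+ 4 = `|x| * `|x| ^+ 3.
    by rewrite -exprS -normrX ger0_norm// exprn_even_ge0.
  by rewrite ler_wpM2l// lerXn2r ?nnegrE ?ltW// (lt_trans e0).
by have := e0; lra.
Qed.

Let m0 : m 0%N = 0.
Proof. by rewrite mE tE v0 !mul0r !mulr0 !mul0r subrr mul0r. Qed.

(** The left hand side telescopes to the square of [m] at the stopping index, the
    last sum to the stopping time.  The term of order y^2 t^2 in the square is at
    most half of the stopping time, because t <= T / q and q >= 32 y^2 / T.  The
    square at the index after the last one spent in the interval costs one
    increment. *)
Lemma path_square :
  \sum_(i < K) (((m i.+1 - m i) ^+ 2 + 2 * (m i * (m i.+1 - m i))) * (s i)%:R) <=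
  16 * h ^+ 2 + 2^-1 * \sum_(i < K) ((t i.+1 - t i) * (s i)%:R) +
  2 * (e ^+ 2 + Q / e ^+ 2).
Proof.
have T_gt0 := T0; have h_gt0 := h0; have e_gt0 := e0.
have [j /andP[j0 jN] sj] := antitone_threshold s0 anti sN.
rewrite (eq_bigr (fun i : 'I_K => (m i.+1 ^+ 2 - m i ^+ 2) * (i < j)%:R)); last first.
  by move=> i _; rewrite sj; congr (_ * _); ring.
rewrite [in leRHS](eq_bigr (fun i : 'I_K => (t i.+1 - t i) * (i < j)%:R)); last first.
  by move=> i _; rewrite sj.
rewrite (stopped_sum (fun i => m i ^+ 2)) (stopped_sum t) m0 expr0n/= subr0.
have -> : t 0%N = 0 by rewrite tE !mul0r.
rewrite subr0; set k := minn j K.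
have kK : (k <= K)%N by rewrite geq_minr.
have tk0 := t0 k.
have quad : 16 * (`|y| * t k / T) ^+ 2 <= 2^-1 * t k.
  have -> : 16 * (`|y| * t k / T) ^+ 2 = t k * (16 * y ^+ 2 / T ^+ 2 * t k).
    by rewrite !exprMn real_normK ?num_real//; field; rewrite gt_eqF.
  rewrite [leRHS]mulrC ler_wpM2l//.
  apply: (@le_trans _ _ (16 * y ^+ 2 / T ^+ 2 * t K)).
    rewrite ler_wpM2l ?t_le//; apply: divr_ge0; last exact: sqr_ge0.
    by rewrite mulr_ge0 ?sqr_ge0.
  rewrite tK (_ : _ * (T / q%:R) = 2^-1 * (32 * y ^+ 2 / T / q%:R)); last first.
    by field; rewrite !gt_eqF.
  by rewrite ler_piMr// ler_pdivrMr// mul1r.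
have sq_bound i : (i <= k)%N -> (i <= K)%N -> s i -> m i ^+ 2 <= 8 * h ^+ 2 + 2^-1 * (2^-1 * t k).
  move=> ik iK si; have := m_bound iK si.
  have : `|y| * t i / T <= `|y| * t k / T.
    by rewrite ler_pM2r ?invr_gt0// ler_wpM2l// t_le.
  set u := `|y| * t k / T in quad *; move=> h1 h2.
  have u0 : 0 <= u by rewrite /u divr_ge0 ?mulr_ge0// ltW.
  have h3 : `|m i| <= 2 * (h + u) by lra.
  have : m i ^+ 2 <= (2 * (h + u)) ^+ 2.
    by rewrite -(real_normK (num_real (m i))) lerXn2r ?nnegrE//; lra.
  by have := sqr_ge0 (h - u); nra.
have err : 0 <= 2 * (e ^+ 2 + Q / e ^+ 2).
  by rewrite mulr_ge0// addr_ge0 ?sqr_ge0// divr_ge0// sqr_ge0.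
case: (ltnP K j) => Kj.
  have kE : k = K by rewrite /k (minn_idPr (ltnW Kj)).
  have := sq_bound k (leqnn _) kK; rewrite sj {1}kE => /(_ Kj).
  have := sqr_ge0 h; lra.
have kE : k = j by rewrite /k (minn_idPl Kj).
have jK : (j.-1 < K)%N by rewrite prednK.
have := sq_bound j.-1; rewrite kE leq_pred (ltnW jK) sj prednK// leqnn => /(_ isT isT isT).
have := small_sqr (Qm jK); rewrite prednK//.
have := sqr_ge0 (m j.-1 - (m j - m j.-1)); nra.
Qed.

(** The first sum telescopes to the value of the path at its last grid time of
    survival, the second to the stopped martingale.  If the path leaves after
    time T / q, then 2 h bounds the difference of two of its values, and
    2 h = 2 h q / T * (T / q) is charged to the stopping time T / q. *)
Lemma path_exit_value :
  `|\sum_(i < N) (v i * ((s i)%:R - (s i.+1)%:R)) -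
    \sum_(i < K) ((m i.+1 - m i) * (s i)%:R)| <=
  (c + 2 * h * q%:R / T) * \sum_(i < K) ((t i.+1 - t i) * (s i)%:R) +
  (e + Q / e ^+ 3).
Proof.
have T_gt0 := T0; have h_gt0 := h0; have e_gt0 := e0.
have [j /andP[j0 jN] sj] := antitone_threshold s0 anti sN.
rewrite (eq_bigr (fun i : 'I_N => v i * ((i < j)%:R - (i.+1 < j)%:R))); last first.
  by move=> i _; rewrite !sj.
rewrite [X in _ - X](eq_bigr (fun i : 'I_K => (m i.+1 - m i) * (i < j)%:R)); last first.
  by move=> i _; rewrite sj.
rewrite [in leRHS](eq_bigr (fun i : 'I_K => (t i.+1 - t i) * (i < j)%:R)); last first.
  by move=> i _; rewrite sj.
rewrite last_value_sum ?j0// (stopped_sum m) (stopped_sum t) m0 subr0.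
have -> : t 0%N = 0 by rewrite tE !mul0r.
rewrite subr0; set k := minn j K.
have c0 : 0 <= c by rewrite /c; apply: divr_ge0; [have := normr_ge0 y; lra|exact: ltW].
have hq : 0 <= 2 * h * q%:R / T by apply: divr_ge0; [apply: mulr_ge0 => //; lra|exact: ltW].
have err : 0 <= e + Q / e ^+ 3.
  by apply: addr_ge0; [exact: ltW|apply: divr_ge0 => //; rewrite exprn_ge0// ltW].
have vj : `|v j.-1| <= h by apply: vh; rewrite sj prednK.
case: (ltnP K j) => Kj.
  have -> : k = K by rewrite /k (minn_idPr (ltnW Kj)).
  have sK : s K by rewrite sj.
  have := v_m (leqnn _) sK; have := vh sK => h1 h2.
  have E : 2 * h * q%:R / T * t K = 2 * h by rewrite tK; field; rewrite !gt_eqF.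
  rewrite mulrDl E.
  have -> : v j.-1 - m K = v j.-1 - v K + (v K - m K) by ring.
  apply: le_trans (ler_normD _ _) _.
  have := ler_normB (v j.-1) (v K); lra.
have -> : k = j by rewrite /k (minn_idPl Kj).
have jK : (j.-1 < K)%N by rewrite prednK.
have sj1 : s j.-1 by rewrite sj prednK.
have := v_m (ltnW jK) sj1; have := small_norm (Qm jK); rewrite prednK// => h1 h2.
have tj : t j.-1 <= t j by rewrite t_le// leq_pred.
have h3 : c * t j.-1 <= c * t j by rewrite ler_wpM2l.
have h4 : 0 <= 2 * h * q%:R / T * t j by rewrite mulr_ge0.
rewrite mulrDl.
have -> : v j.-1 - m j = v j.-1 - m j.-1 - (m j - m j.-1) by ring.
apply: le_trans (ler_normB _ _) _; lra.
Qed.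

End path_inequalities.

(** * Mean of the discrete exit value *)

Section expectation_tools.
Context d (Om : measurableType d) (R : realType) (P : probability Om R).
Local Notation L1 f := (P.-integrable setT (EFin \o f)).

Lemma Rintegral_sum I (r : seq I) (f : I -> Om -> R) : (forall i, L1 (f i)) ->
  \int[P]_w (\sum_(i <- r) f i w) = \sum_(i <- r) \int[P]_w f i w.
Proof.
move=> Lf; elim: r => [|i r IH].
  by rewrite big_nil; under eq_Rintegral do rewrite big_nil; exact: Rintegral_cst_prob.
rewrite big_cons -IH -RintegralD//; last exact: L1_sum.
by apply: eq_Rintegral => w _; rewrite big_cons.
Qed.

(* Comparison with the minimum of f and g, which is almost everywhere f. *)
Lemma ae_le_Rintegral (f g : Om -> R) : L1 f -> L1 g ->
  {ae P, forall w, f w <= g w} -> \int[P]_w f w <= \int[P]_w g w.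
Proof.
move=> Lf Lg fg; have mf := L1_measurable Lf; have mg := L1_measurable Lg.
have mfg : measurable_fun setT (fun w => Num.min (f w) (g w)) by exact: measurable_minr.
have -> : \int[P]_w f w = \int[P]_w Num.min (f w) (g w).
  congr fine; apply: ae_eq_integral => //; try exact/measurable_EFinP.
  by apply: filterS fg => w fgw _; rewrite min_l.
apply: le_Rintegral => //; last by move=> w _; rewrite ge_min lexx orbT.
apply: (@L1_le _ _ _ _ _ (fun w => `|f w| + `|g w|)) => //.
  by apply: L1_D; exact: L1_norm.
by move=> w; rewrite minEle; case: ifP => _; rewrite ?lerDl ?lerDr.
Qed.

End expectation_tools.

Section discrete_exit.
Context d (Om : measurableType d) (R : realType) (P : probability Om R).
Local Notation L1 f := (P.-integrable setT (EFin \o f)).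
Variables (T y : R) (B : R -> {RV P >-> R}).
Hypotheses (T0 : 0 < T) (bB : brownian_bridge T y B).
Let b (t : R) : Om -> R := B t.
Variables (lo up : R) (q : nat).
Hypotheses (lo0 : lo < 0) (up0 : 0 < up) (ye : ~~ (lo < y < up)).
Hypotheses (q2 : (2 <= q)%N) (qy : 32 * y ^+ 2 / T <= q%:R).
Let h := up - lo.
Let h0 : 0 < h.
Proof. by rewrite /h subr_gt0 (lt_trans lo0). Qed.

Let path_continuous w : {within `[0, T], continuous (fun t => b t w)}.
Proof. by case: bB => + _ _ _; exact. Qed.

(** The value itself is unbounded, but its product with the survival indicator is a
    bounded limit of functions of the past. *)
Lemma adapted_path_survives t : 0 <= t <= T ->
  adapted (past b t) (fun w => b t w * (survives b lo up t w)%:R).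
Proof.
move=> tT; apply: (@adapted_lim _ _ _ _ h
  (fun k w => sin_approx k (b t w) * (survives b lo up t w)%:R)).
- move=> k; apply: adapted_mul; last exact: (adapted_survives path_continuous).
  rewrite /sin_approx; apply: adapted_scale.
  under eq_fun do rewrite mulrC -[X in sin X]addr0.
  by apply: adapted_sin; exists t => //; rewrite lexx andbT; case/andP: tT.
- move=> k w; case: (boolP (survives b lo up t w)) => [/asboolP S|_]; last first.
    by rewrite mulr0 normr0 ltW.
  rewrite mulr1; apply: le_trans (sin_approx_le _ _) _.
  have /andP[h1 h2] : lo < b t w < up by apply: S; rewrite lexx andbT; case/andP: tT.
  by rewrite ler_norml /h; move: lo0 up0 => ? ?; apply/andP; split; lra.
- by move=> w; apply: cvgM; [exact: cvg_sin_approx|exact: cvg_cst].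
Qed.

Variable K : nat.
Hypothesis K0 : (0 < K)%N.
Let N := (q * K)%N.

Definition grid (i : nat) : R := i%:R * T / N%:R.
Definition alive (i : nat) (w : Om) : bool := survives b lo up (grid i) w.
(** The value of the path at the last grid time up to which it has survived. *)
Definition discrete_exit (w : Om) : R :=
  \sum_(i < N) (b (grid i) w * ((alive i w)%:R - (alive i.+1 w)%:R)).

Let q0 : 0 < q%:R :> R. Proof. by rewrite ltr0n; apply: leq_trans q2. Qed.
Let KR : 0 < K%:R :> R. Proof. by rewrite ltr0n. Qed.
Let NE : N%:R = q%:R * K%:R :> R. Proof. by rewrite natrM. Qed.
Let NR : 0 < N%:R :> R. Proof. by rewrite NE mulr_gt0. Qed.

Lemma grid_ge0 i : 0 <= grid i.
Proof. by apply: divr_ge0 => //; apply: mulr_ge0 => //; exact: ltW. Qed.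

Lemma grid_le i k : (i <= k)%N -> grid i <= grid k.
Proof.
move=> ik; rewrite /grid ler_pM2r ?invr_gt0//.
by rewrite ler_pM2r// ler_nat.
Qed.

Lemma grid_step i : grid i.+1 - grid i = T / N%:R.
Proof. by rewrite /grid -natr1; field; rewrite gt_eqF. Qed.

Lemma gridN : grid N = T.
Proof. by rewrite /grid mulrAC divff ?mul1r// gt_eqF. Qed.

Lemma grid_half i : (i <= K)%N -> grid i <= T / 2.
Proof.
move=> iK; apply: le_trans (grid_le iK) _.
have -> : grid K = T / q%:R by rewrite /grid NE; field; rewrite !gt_eqF.
by rewrite ler_pM2l// lef_pV2 ?posrE// ler_nat.
Qed.

Lemma grid_itv i : (i <= N)%N -> 0 <= grid i <= T.
Proof. by move=> iN; rewrite grid_ge0/= -gridN grid_le. Qed.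

Let KN : (K <= N)%N. Proof. by rewrite /N leq_pmull// (leq_trans _ q2). Qed.

Lemma alive_adapted i : (i <= N)%N -> adapted (past b (grid i)) (fun w => (alive i w)%:R).
Proof. by move=> iN; apply: (adapted_survives path_continuous); exact: grid_itv. Qed.

Let mart i w := martingale T y B (grid i) w.
Let dM i w := mart i.+1 w - mart i w.
Let dA i := clock T (grid i.+1) - clock T (grid i).

Let step_lt i : (i < K)%N -> grid i <= grid i.+1 /\ grid i.+1 < T.
Proof.
move=> iK; split; first exact: grid_le.
by have := grid_half iK; have := T0 => ? ?; lra.
Qed.

Let iN i : (i < K)%N -> (i <= N)%N. Proof. by move=> /ltnW iK; exact: leq_trans KN. Qed.

(* Up to time T / 2 the clock runs at a speed between 1 and 4. *)
Let dA_bounds i : (i < K)%N -> T / N%:R <= dA i <= 4 * (T / N%:R).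
Proof.
move=> iK; have := grid_half iK; have := grid_ge0 i; have [] := step_lt iK.
have T1 := T0; move=> h1 h2 h3 h4.
have u1 : 0 < T - grid i by lra.
have u2 : 0 < T - grid i.+1 by lra.
have E : dA i = T / N%:R * (T / (T - grid i) * (T / (T - grid i.+1))).
  by rewrite -(grid_step i) /dA /clock; field; rewrite !gt_eqF.
have p0 : 0 < T / N%:R by rewrite divr_gt0.
have r1 : 1 <= T / (T - grid i) <= 2.
  by apply/andP; split; rewrite ?ler_pdivlMr ?ler_pdivrMr//; lra.
have r2 : 1 <= T / (T - grid i.+1) <= 2.
  by apply/andP; split; rewrite ?ler_pdivlMr ?ler_pdivrMr//; lra.
rewrite E [4 * _]mulrC; move: r1 r2 => /andP[r1 r1'] /andP[r2 r2'].
rewrite ler_pMr// ler_pM2l//; apply/andP; split; nra.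
Qed.

Let orth i : (i < K)%N -> trig_orthogonal P (past b (grid i)) (dM i).
Proof. by move=> iK; have [] := step_lt iK; apply: increment_orthogonal => //; exact: grid_ge0. Qed.

Let orth2 i : (i < K)%N ->
  trig_orthogonal P (past b (grid i)) (fun w => dM i w ^+ 2 - dA i).
Proof. by move=> iK; have [] := step_lt iK; apply: increment_sqr_orthogonal => //; exact: grid_ge0. Qed.

Let mpast i f : past b (grid i) f -> measurable_fun setT f.
Proof. exact: past_measurable. Qed.

Let L1_adapted (F : set (Om -> R)) U : (forall f, F f -> measurable_fun setT f) ->
  adapted F U -> L1 U.
Proof.
move=> mF aU; have [M HM] := adapted_bounded aU.
exact: L1_le (adapted_measurable mF aU) (L1_cst P M) HM.
Qed.

Let mart_aliveA i : (i < K)%N ->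
  adapted (past b (grid i)) (fun w => mart i w * (alive i w)%:R).
Proof.
move=> iK; have gT := grid_itv (iN iK).
have -> : (fun w => mart i w * (alive i w)%:R) = (fun w => T / (T - grid i) *
    (b (grid i) w * (alive i w)%:R - y * grid i / T * (alive i w)%:R)).
  by apply/funext => w; rewrite /mart /martingale /b /=; ring.
apply: adapted_scale; apply: adapted_sub; first exact: adapted_path_survives.
by apply: adapted_scale; exact: alive_adapted (iN iK).
Qed.

Let stopped w := \sum_(i < K) (dM i w * (alive i w)%:R).
Let duration w := \sum_(i < K) ((grid i.+1 - grid i) * (alive i w)%:R).
Let stopped_sqr w :=
  \sum_(i < K) ((dM i w ^+ 2 + 2 * (mart i w * dM i w)) * (alive i w)%:R).
Let Q w := \sum_(i < K) dM i w ^+ 4.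

Let L1_stopped_term (i : 'I_K) : L1 (fun w => dM i w * (alive i w)%:R).
Proof.
exact: (adapted_preserves (@mpast i) (orth (ltn_ord i)) (alive_adapted (iN (ltn_ord i)))).1.
Qed.

Let L1_stopped : L1 stopped.
Proof. by apply: L1_sum => i; exact: L1_stopped_term. Qed.

Let stopped_mean : \int[P]_w stopped w = 0.
Proof.
rewrite Rintegral_sum; last exact: L1_stopped_term.
apply: big1 => i _.
exact: (adapted_orthogonal (@mpast i) (orth (ltn_ord i)) (alive_adapted (iN (ltn_ord i)))).
Qed.

Let L1_alive i : (i <= N)%N -> L1 (fun w => (alive i w)%:R).
Proof. by move=> iN'; exact: L1_adapted (@mpast i) (alive_adapted iN'). Qed.

Let L1_duration : L1 duration.
Proof. by apply: L1_sum => i; apply: L1_Zl; exact/L1_alive/iN. Qed.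

(* The increment of M^2 is 2 M dM + dM^2, and dM^2 has conditional mean dA. *)
Let sqr_split i w : (dM i w ^+ 2 + 2 * (mart i w * dM i w)) * (alive i w)%:R =
  ((dM i w ^+ 2 - dA i) * (alive i w)%:R + dA i * (alive i w)%:R) +
  2 * (dM i w * (mart i w * (alive i w)%:R)).
Proof. by ring. Qed.

Let L1_sqr_term (i : 'I_K) : [/\ L1 (fun w => (dM i w ^+ 2 - dA i) * (alive i w)%:R),
  L1 (fun w => dA i * (alive i w)%:R) &
  L1 (fun w => 2 * (dM i w * (mart i w * (alive i w)%:R)))].
Proof.
split.
- exact: (adapted_preserves (@mpast i) (orth2 (ltn_ord i)) (alive_adapted (iN (ltn_ord i)))).1.
- by apply: L1_Zl; exact/L1_alive/iN.
- apply: L1_Zl.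
  exact: (adapted_preserves (@mpast i) (orth (ltn_ord i)) (mart_aliveA (ltn_ord i))).1.
Qed.

Let L1_sqr_sum (i : 'I_K) :
  L1 (fun w => (dM i w ^+ 2 + 2 * (mart i w * dM i w)) * (alive i w)%:R).
Proof.
under eq_fun do rewrite sqr_split.
by have [? ? ?] := L1_sqr_term i; apply: L1_D => //; exact: L1_D.
Qed.

Let duration_le : \int[P]_w duration w <= \int[P]_w stopped_sqr w.
Proof.
rewrite Rintegral_sum; last by move=> i; apply: L1_Zl; exact/L1_alive/iN.
rewrite Rintegral_sum; last exact: L1_sqr_sum.
apply: ler_sum => i _; have iK := ltn_ord i.
have [l1 l2 l3] := L1_sqr_term i.
have -> : \int[P]_w ((dM i w ^+ 2 + 2 * (mart i w * dM i w)) * (alive i w)%:R) =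
    \int[P]_w (((dM i w ^+ 2 - dA i) * (alive i w)%:R + dA i * (alive i w)%:R) +
    2 * (dM i w * (mart i w * (alive i w)%:R))).
  by apply: eq_Rintegral => w _; exact: sqr_split.
rewrite RintegralD//; last exact: L1_D.
rewrite RintegralD// [X in X + _ + _](adapted_orthogonal (@mpast i) (orth2 iK) (alive_adapted (iN iK))).
have LmM := (adapted_preserves (@mpast i) (orth iK) (mart_aliveA iK)).1.
rewrite (RintegralZl 2 measurableT LmM).
rewrite (adapted_orthogonal (@mpast i) (orth iK) (mart_aliveA iK)) mulr0 addr0 add0r.
have La := L1_alive (iN iK).
rewrite (RintegralZl (grid i.+1 - grid i) measurableT La) (RintegralZl (dA i) measurableT La).
rewrite grid_step ler_wpM2r ?Rintegral_ge0//.
by have /andP[] := dA_bounds iK.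
Qed.

Let L1_Q : L1 Q.
Proof.
by apply: L1_sum => i; have [] := step_lt (ltn_ord i); apply: increment_L4 => //; exact: grid_ge0.
Qed.

(* Each of the K terms is 3 dA^2 <= 3 (4 T / N)^2, and N >= K. *)
Let Q_mean : \int[P]_w Q w <= 48 * T ^+ 2 / K%:R.
Proof.
have L4 (i : 'I_K) : L1 (fun w => dM i w ^+ 4).
  by have [] := step_lt (ltn_ord i); apply: increment_L4 => //; exact: grid_ge0.
rewrite Rintegral_sum//.
have term (i : 'I_K) : \int[P]_w (dM i w ^+ 4) <= 48 * T ^+ 2 / K%:R ^+ 2.
  have [h1 h2] := step_lt (ltn_ord i).
  rewrite (increment_moment4 T0 bB (grid_ge0 i) h1 h2) -/(dA i).
  have /andP[d1 d2] := dA_bounds (ltn_ord i).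
  have p0 : 0 < T / N%:R by rewrite divr_gt0.
  have NK : T / N%:R <= T / K%:R by rewrite ler_pM2l// lef_pV2 ?posrE// ler_nat.
  have : dA i ^+ 2 <= (4 * (T / K%:R)) ^+ 2.
    by rewrite lerXn2r ?nnegrE; lra.
  have -> : (4 * (T / K%:R)) ^+ 2 = 16 * T ^+ 2 / K%:R ^+ 2 by field; rewrite gt_eqF.
  have -> : 48 * T ^+ 2 / K%:R ^+ 2 = 3 * (16 * T ^+ 2 / K%:R ^+ 2).
    by field; rewrite gt_eqF.
  by move=> h4; rewrite ler_pM2l.
apply: (@le_trans _ _ (\sum_(i < K) (48 * T ^+ 2 / K%:R ^+ 2))).
  by apply: ler_sum => i _; exact: term.
rewrite sumr_const card_ord -mulr_natr.
by apply: ler_eq_imp; field; rewrite gt_eqF.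
Qed.

Lemma alive_anti i w : alive i.+1 w -> alive i w.
Proof.
move=> /asboolP H; apply/asboolP => s /andP[s0 si]; apply: H.
by rewrite s0 (le_trans si)// grid_le.
Qed.

Let alive_bound i w : alive i w -> `|b (grid i) w| <= h.
Proof.
move=> /asboolP /(_ (grid i)); rewrite grid_ge0 lexx => /(_ isT) /andP[h1 h2].
by rewrite ler_norml /h; move: lo0 up0 => ? ?; apply/andP; split; lra.
Qed.

Lemma alive0 w : b 0 w = 0 -> alive 0 w.
Proof.
move=> b00; apply/asboolP => s.
have -> : grid 0 = 0 by rewrite /grid !mul0r.
by move=> s0; have -> : s = 0 by [apply/le_anti; rewrite andbC]; rewrite b00 lo0.
Qed.

Lemma aliveN w : b T w = y -> ~~ alive N w.
Proof.
move=> bT; apply/asboolP => /(_ T); rewrite gridN lexx ltW// bT => /(_ isT).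
by rewrite (negbTE ye).
Qed.

Let Qterm w i : (i < K)%N -> dM i w ^+ 4 <= Q w.
Proof.
move=> iK; rewrite /Q (bigD1 (Ordinal iK))//= lerDl.
by apply: sumr_ge0 => k _; rewrite exprn_even_ge0.
Qed.

Lemma discrete_exit_measurable : measurable_fun setT discrete_exit.
Proof.
have ma i : (i <= N)%N -> measurable_fun setT (fun w => (alive i w)%:R : R).
  by move=> iN'; exact: L1_measurable (L1_alive iN').
apply: measurable_sum => i; apply: measurable_funM; first exact: measurable_funPT.
by apply: measurable_funB; apply: ma => //; exact: ltnW.
Qed.

Lemma discrete_exit_bounded w : `|discrete_exit w| <= h.
Proof.
have zero : (forall i : 'I_N, alive i w = alive i.+1 w) -> `|discrete_exit w| <= h.
  move=> E; rewrite /discrete_exit big1 ?normr0 ?(ltW h0)// => i _.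
  by rewrite E subrr mulr0.
have down i k : alive (i + k)%N w -> alive i w.
  by elim: k => [|k IH]; rewrite ?addn0// addnS => /alive_anti.
have [a0|a0] := boolP (alive 0 w); last first.
  apply: zero => i; have f k : alive k w = false.
    by apply: contraNF a0 => /(down 0%N k).
  by rewrite !f.
have [aN|aN] := boolP (alive N w).
  apply: zero => i; have f k : (k <= N)%N -> alive k w.
    by move=> kN; apply: (@down k (N - k)%N); rewrite subnKC.
  by rewrite !f// ltnW.
have [j jN aj] := antitone_threshold a0 (fun i => @alive_anti i w) aN.
rewrite /discrete_exit.
rewrite (eq_bigr (fun i : 'I_N => b (grid i) w * ((i < j)%:R - (i.+1 < j)%:R))).
  rewrite (last_value_sum (fun i => b (grid i) w))//; apply: alive_bound.
  by rewrite aj prednK//; case/andP: jN.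
by move=> i _; rewrite !aj.
Qed.

Lemma discrete_exit_L1 : L1 discrete_exit.
Proof.
exact: L1_le discrete_exit_measurable (L1_cst P h) discrete_exit_bounded.
Qed.

Let L1_stopped_sqr : L1 stopped_sqr.
Proof. by apply: L1_sum => i; exact: L1_sqr_sum. Qed.

Let r := 48 * T ^+ 2 / K%:R.

Let duration_mean (e : R) : 0 < e ->
  \int[P]_w duration w <= 32 * h ^+ 2 + 4 * (e ^+ 2 + r / e ^+ 2).
Proof.
move=> e0; have e20 : 0 < e ^+ 2 by rewrite exprn_gt0.
have LR : L1 (fun w => 16 * h ^+ 2 + 2^-1 * duration w + 2 * (e ^+ 2 + e ^- 2 * Q w)).
  apply: L1_D; first by apply: L1_D; [exact: L1_cst|exact: L1_Zl].
  by apply: L1_Zl; apply: L1_D; [exact: L1_cst|exact: L1_Zl].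
have H : \int[P]_w stopped_sqr w <=
    \int[P]_w (16 * h ^+ 2 + 2^-1 * duration w + 2 * (e ^+ 2 + e ^- 2 * Q w)).
  apply: ae_le_Rintegral => //.
  apply: filterS (bridge_endpoints T0 bB) => w [b00 bT].
  have := @path_square R T y h e (Q w) q K T0 h0 e0 K0 q2 qy grid (fun=> erefl)
    (fun i => b (grid i) w) (alive^~ w) (alive0 b00) (fun i => @alive_anti i w) (aliveN bT)
    _ (fun i => @alive_bound i w) (mart^~ w) (fun=> erefl) (@Qterm w).
  rewrite {1}/grid !mul0r => /(_ b00); rewrite -/(stopped_sqr w) -/(duration w).
  by rewrite [Q w / _]mulrC.
have E : \int[P]_w (16 * h ^+ 2 + 2^-1 * duration w + 2 * (e ^+ 2 + e ^- 2 * Q w)) =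
    16 * h ^+ 2 + 2^-1 * \int[P]_w duration w + 2 * (e ^+ 2 + e ^- 2 * \int[P]_w Q w).
  have Lc c : L1 (fun=> c) := L1_cst P c.
  have LeQ := L1_Zl (e ^- 2) L1_Q.
  have Ld := L1_Zl 2^-1 L1_duration.
  have LQ : L1 (fun w => e ^+ 2 + e ^- 2 * Q w) := L1_D (Lc (e ^+ 2)) LeQ.
  rewrite RintegralD//; [|exact: L1_D|exact: L1_Zl].
  rewrite RintegralD// (RintegralZl 2^-1 measurableT L1_duration).
  rewrite (RintegralZl 2 measurableT LQ) RintegralD//.
  by rewrite (RintegralZl (e ^- 2) measurableT L1_Q) !Rintegral_cst_prob.
have Qe : e ^- 2 * \int[P]_w Q w <= r / e ^+ 2.
  by rewrite mulrC ler_pM2r ?invr_gt0//; exact: Q_mean.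
by have := le_trans duration_le H; rewrite E; lra.
Qed.

(** Optional stopping for the martingale of the bridge bounds the mean of the
    exit value by the mean of the stopping time, and optional stopping for its
    square bounds the latter by the squared width of the interval. *)
Lemma discrete_exit_mean (e : R) : 0 < e ->
  `|\int[P]_w discrete_exit w| <=
    ((2 * h + 2 * `|y|) / T + 2 * h * q%:R / T) *
    (32 * h ^+ 2 + 4 * (e ^+ 2 + r / e ^+ 2)) + (e + r / e ^+ 3).
Proof.
move=> e0; set c := _ / T + _ / T.
have T_gt0 := T0; have h_gt0 := h0.
have c0 : 0 <= c.
  by rewrite /c; apply: addr_ge0; apply: divr_ge0; rewrite ?(ltW T0)//;
    [have := normr_ge0 y; lra|apply: mulr_ge0 => //; lra].
have e30 : 0 < e ^+ 3 by rewrite exprn_gt0.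
have LR : L1 (fun w => c * duration w + (e + e ^- 3 * Q w)).
  by apply: L1_D; [exact: L1_Zl|apply: L1_D; [exact: L1_cst|exact: L1_Zl]].
have LD : L1 (fun w => discrete_exit w - stopped w).
  by apply: L1_B => //; exact: discrete_exit_L1.
have -> : \int[P]_w discrete_exit w = \int[P]_w (discrete_exit w - stopped w).
  by rewrite RintegralB ?stopped_mean ?subr0//; exact: discrete_exit_L1.
apply: le_trans (le_normr_Rintegral measurableT LD) _.
have H : \int[P]_w `|discrete_exit w - stopped w| <=
    \int[P]_w (c * duration w + (e + e ^- 3 * Q w)).
  apply: ae_le_Rintegral => //; first exact: L1_norm.
  apply: filterS (bridge_endpoints T0 bB) => w [b00 bT].
  have := @path_exit_value R T y h e (Q w) q K T0 h0 e0 K0 q2 grid (fun=> erefl)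
    (fun i => b (grid i) w) (alive^~ w) (alive0 b00) (fun i => @alive_anti i w) (aliveN bT)
    _ (fun i => @alive_bound i w) (mart^~ w) (fun=> erefl) (@Qterm w).
  rewrite {1}/grid !mul0r => /(_ b00).
  rewrite -/(discrete_exit w) -/(stopped w) -/(duration w) -/c.
  by rewrite [Q w / _]mulrC.
apply: le_trans H _.
rewrite RintegralD//; [|exact: L1_Zl|by apply: L1_D; [exact: L1_cst|exact: L1_Zl]].
rewrite (RintegralZl c measurableT L1_duration).
rewrite RintegralD//; [|exact: L1_cst|exact: L1_Zl].
rewrite Rintegral_cst_prob RintegralZl// lerD//.
  by rewrite ler_wpM2l// duration_mean.
by rewrite lerD2l mulrC ler_pM2r ?invr_gt0//; exact: Q_mean.
Qed.

End discrete_exit.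

(** * Mean of the exit value *)

(** The exit value of an exceptional path, and the integrand of the theorem as a
    function of x, need not be measurable; the integral of a nonnegative function
    is nevertheless monotone, being a supremum over simple functions below it. *)

Section integrals_without_measurability.
Local Open Scope ereal_scope.
Context d (T : measurableType d) (R : realType) (mu : {measure set T -> \bar R}).
Implicit Types f g : T -> \bar R.

Import HBNNSimple.

Lemma ge0_le_upper_integral f g : (forall x, 0 <= f x) -> (forall x, f x <= g x) ->
  \int[mu]_x f x <= \int[mu]_x g x.
Proof.
move=> f0 fg; have g0 x : 0 <= g x by exact: le_trans (fg x).
rewrite !ge0_integralTE//.
apply: le_ereal_sup => _ [h hf <-]; exists h => // x.
exact: le_trans (hf x) (fg x).
Qed.

Lemma ge0_le_integral_off_null (N : set T) f g : measurable N -> mu N = 0 ->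
  (forall x, 0 <= f x) -> (forall x, 0 <= g x) -> measurable_fun setT g ->
  (forall x, ~ N x -> f x <= g x) -> \int[mu]_x f x <= \int[mu]_x g x.
Proof.
move=> mN N0 f0 g0 mg fg.
(* G dominates f everywhere and equals g almost everywhere. *)
pose G x := g x + (+oo * (\1_N x)%:E).
have G0 x : 0 <= G x by rewrite adde_ge0// mule_ge0// lee_fin.
have -> : \int[mu]_x g x = \int[mu]_x G x.
  apply: ge0_ae_eq_integral => //.
    apply: emeasurable_funD => //; apply: emeasurable_funM => //.
    exact/measurable_EFinP/measurable_indic.
  exists N; split => // x /= H; apply: contrapT => Nx; apply: H => _.
  by rewrite /G indicE memNset// mule0 adde0.
apply: ge0_le_upper_integral => // x; rewrite /G indicE.
have [xN|xN] := boolP (x \in N).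
  rewrite mule1 addey ?leey//.
  by rewrite gt_eqF// (lt_le_trans _ (g0 x))// ltNy0.
by rewrite mule0 adde0 fg// => Nx; move/negP: xN; apply; exact/mem_set.
Qed.

Lemma ge0_integral_off_null (N : set T) f g : measurable N -> mu N = 0 ->
  (forall x, 0 <= f x) -> (forall x, 0 <= g x) -> measurable_fun setT g ->
  (forall x, g x <= f x) -> (forall x, ~ N x -> f x = g x) ->
  \int[mu]_x f x = \int[mu]_x g x.
Proof.
move=> mN N0 f0 g0 mg gf fg; apply/le_anti/andP; split; last exact: ge0_le_upper_integral.
by apply: (ge0_le_integral_off_null mN N0) => // x /fg ->.
Qed.

End integrals_without_measurability.

Section integral_off_null.
Local Open Scope ereal_scope.
Context d (T : measurableType d) (R : realType) (mu : {measure set T -> \bar R}).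

(** Changing an integrand to zero on a null set does not require it to be
    measurable there. *)
Lemma integral_off_null (N : set T) (f g : T -> R) : measurable N -> mu N = 0 ->
  measurable_fun setT g -> (forall x, N x -> g x = 0%R) -> (forall x, ~ N x -> f x = g x) ->
  \int[mu]_x (f x)%:E = \int[mu]_x (g x)%:E.
Proof.
move=> mN N0 mg g0 fg; rewrite integralE [RHS]integralE.
have mge : measurable_fun setT (fun x => (g x)%:E) by exact/measurable_EFinP.
congr (_ - _); apply: (ge0_integral_off_null mN N0) => //.
- exact: measurable_funepos.
- move=> x; rewrite !funeposE; have [Nx|Nx] := pselect (N x); last by rewrite fg.
  by rewrite g0// maxxx le_max lexx orbT.
- by move=> x Nx; rewrite !funeposE fg.
- exact: measurable_funeneg.
- move=> x; rewrite !funenegE; have [Nx|Nx] := pselect (N x); last by rewrite fg.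
  by rewrite g0// oppe0 maxxx le_max lexx orbT.
- by move=> x Nx; rewrite !funenegE fg.
Qed.

End integral_off_null.

Section exit_value.
Context d (Om : measurableType d) (R : realType) (P : probability Om R).
Local Notation L1 f := (P.-integrable setT (EFin \o f)).
Variables (T y : R) (B : R -> {RV P >-> R}).
Hypotheses (T0 : 0 < T) (bB : brownian_bridge T y B).
Let b (t : R) : Om -> R := B t.
Variables (lo up : R) (q : nat).
Hypotheses (lo0 : lo < 0) (up0 : 0 < up) (ye : ~~ (lo < y < up)).
Hypotheses (q2 : (2 <= q)%N) (qy : 32 * y ^+ 2 / T <= q%:R).
Let h := up - lo.

Let tau w := exit_time T lo up (fun t => b t w).

(* The infimum defining the exit time lies between the last grid time of survival
   and the next grid time. *)
Let exit_between k w : b 0 w = 0 -> b T w = y -> exists t,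
  [/\ discrete_exit T B lo up q k.+1 w = b t w, 0 <= t <= T,
      t <= tau w <= t + T / k.+1%:R & 0 <= tau w <= T].
Proof.
move=> b00 bT.
have a0 : alive T B lo up q k.+1 0 w by exact: alive0.
have aN := aliveN T0 ye q2 (ltn0Sn k) bT.
have anti i := @alive_anti _ _ _ P T B T0 lo up q q2 k.+1 (ltn0Sn k) i w.
have [j jN aj] := antitone_threshold a0 anti aN.
have /andP[j0 jN'] := jN.
have sN : has_inf [set t : R | t \in `]0, T] /\ b t w \notin `]lo, up[].
  split; last by exists 0 => t [+ _]; rewrite in_itv/= => /andP[/ltW].
  by exists T => /=; rewrite !in_itv/= T0 lexx bT.
have gj := grid_itv T0 q2 (ltn0Sn k) jN'.
have gj1 := grid_itv T0 q2 (ltn0Sn k) (leq_trans (leq_pred j) jN').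
have g1 : grid T q k.+1 j.-1 <= tau w.
  apply: lb_le_inf; first by case: sN.
  move=> t [+ tex]; rewrite in_itv/= => /andP[t0 tT].
  rewrite leNgt; apply/negP => tg.
  have : alive T B lo up q k.+1 j.-1 w by rewrite aj prednK.
  move=> /asboolP/(_ t); rewrite (ltW t0) (ltW tg) => /(_ isT).
  by move: tex; rewrite in_itv/= => /negP.
have g2 : tau w <= grid T q k.+1 j.
  have : ~~ alive T B lo up q k.+1 j w by rewrite aj ltnn.
  move=> /asboolP/existsNP[t /not_implyP[/andP[t0 tg] /negP tex]].
  apply: (@le_trans _ _ t) => //; apply: ge_inf; first by case: sN.
  split; last by rewrite in_itv/=.
  have tT : t <= T by rewrite (le_trans tg)//; case/andP: gj.
  rewrite in_itv/= lt_neqAle t0 tT !andbT.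
  by apply/eqP => t00; move: tex; rewrite -t00 -/(b 0 w) b00 lo0 up0.
have step : grid T q k.+1 j <= grid T q k.+1 j.-1 + T / k.+1%:R.
  rewrite -lerBlDl -{1}(prednK j0) (grid_step T q2 (ltn0Sn k)).
  by rewrite ler_pM2l// lef_pV2 ?posrE ?ltr0n ?muln_gt0 ?(ltnW q2)// ler_nat leq_pmull// ltnW.
exists (grid T q k.+1 j.-1); split => //.
- rewrite /discrete_exit.
  rewrite (eq_bigr (fun i : 'I_(q * k.+1) =>
    b (grid T q k.+1 i) w * ((i < j)%:R - (i.+1 < j)%:R))).
    exact: (last_value_sum (fun i => b (grid T q k.+1 i) w)).
  by move=> i _; rewrite !aj.
- by rewrite g1/= (le_trans g2 step).
- case/andP: gj1 => g10 _; case/andP: gj => _ gT.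
  by rewrite (le_trans g10 g1) (le_trans g2 gT).
Qed.

Let discrete_exit_cvg w : b 0 w = 0 -> b T w = y ->
  discrete_exit T B lo up q k.+1 w @[k --> \oo] --> b (tau w) w.
Proof.
move=> b00 bT; have cb : {within `[0, T], continuous (fun t => b t w)}.
  by case: bB => + _ _ _; exact.
have [_ [_ _ _ tauT]] := exit_between 0 b00 bT.
apply/cvgrPdist_lt => e e0.
have [r r0 Hr] := within_segment_dist cb tauT e0.
exists (Num.truncn (T / r)) => // k /= kT.
have [t [-> tT /andP[t1 t2] _]] := exit_between k b00 bT.
apply: Hr => //.
have k0 : 0 < k.+1%:R :> R by rewrite ltr0n.
have : T / k.+1%:R < r.
  rewrite ltr_pdivrMr// mulrC -ltr_pdivrMr//.
  by rewrite (lt_le_trans (truncnS_gt _))// ler_nat.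
by move=> h1; rewrite ger0_norm ?subr_ge0// ltrBlDl (le_lt_trans t2)// ltrD2l.
Qed.

(** The bound of [discrete_exit_mean] with e = h^2, in the limit of a vanishing grid
    step, where r = 48 T^2 / k disappears. *)
Lemma exit_mean_bound :
  (`| 'E_P[fun w => b (tau w) w] | <=
   (((2 * h + 2 * `|y|) / T + 2 * h * q%:R / T) * (32 * h ^+ 2 + 4 * h ^+ 4) + h ^+ 2)%:E)%E.
Proof.
have h0 : 0 < h by rewrite /h subr_gt0 (lt_trans lo0).
pose A := [set w | b 0 w = 0] `&` [set w | b T w = y].
have mA : measurable A.
  have mpin t z : measurable [set w | b t w = z].
    by have := @measurable_funPT _ _ _ _ (B t) measurableT _ (measurable_set1 z); rewrite setTI.
  exact: measurableI.
have PA : P (~` A) = 0%E.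
  apply/(@negligibleP _ _ _ P); first exact: measurableC.
  have := bridge_endpoints T0 bB; apply: negligibleS => w /= nA [b00 bT].
  by apply: nA; split.
have m1 : measurable_fun setT (\1_A : Om -> R) by exact: measurable_indic.
have abs1 w : `|\1_A w : R| <= 1.
  by rewrite indicE normr_nat; case: (_ \in _).
pose u k w : R := discrete_exit T B lo up q k.+1 w * \1_A w.
pose F w : R := b (tau w) w * \1_A w.
(* On the null set outside A the exit value is replaced by 0. *)
have mdx k := discrete_exit_measurable T0 bB lo up q2 (ltn0Sn k).
have mu k : measurable_fun setT (u k) by exact: measurable_funM.
have uF w : u k w @[k --> \oo] --> F w.
  rewrite /u /F indicE; have [/set_mem [b00 bT]|_] := boolP (w \in A).
    by apply: cvgM; [exact: discrete_exit_cvg|exact: cvg_cst].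
  by rewrite mulr0; under eq_fun do rewrite mulr0; exact: cvg_cst.
have uh k w : `|u k w| <= h.
  rewrite /u normrM -[leRHS]mulr1; apply: ler_pM => //.
  exact: (discrete_exit_bounded B T0 lo0 up0 q2 (ltn0Sn k)).
have [LF cF] := dominated_cvg_Rintegral mu uF (L1_cst P h) uh.
have EF : ('E_P[fun w => b (tau w) w] = (\int[P]_w F w)%:E)%E.
  rewrite unlock (integral_off_null (N := ~` A) (g := F))//.
  - by rewrite /Rintegral fineK//; exact: integrable_fin_num.
  - exact: measurableC.
  - exact: L1_measurable LF.
  - by move=> w nA; rewrite /F indicE memNset// mulr0.
  - by move=> w /contrapT Aw; rewrite /F indicE mem_set// mulr1.
rewrite EF /= lee_fin.
pose c := (2 * h + 2 * `|y|) / T + 2 * h * q%:R / T.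
pose r k : R := 48 * T ^+ 2 / k.+1%:R.
have bound k : `|\int[P]_w u k w| <=
    c * (32 * h ^+ 2 + 4 * ((h ^+ 2) ^+ 2 + r k / (h ^+ 2) ^+ 2)) +
    (h ^+ 2 + r k / (h ^+ 2) ^+ 3).
  have -> : \int[P]_w u k w = \int[P]_w discrete_exit T B lo up q k.+1 w.
    congr fine; apply: ae_eq_integral => //; try exact/measurable_EFinP.
    exists (~` A); split => //; first exact: measurableC.
    move=> w /= H Aw; apply: H => _.
    by rewrite /u indicE mem_set// mulr1.
  exact: (discrete_exit_mean T0 bB lo0 up0 ye q2 qy (ltn0Sn k) (exprn_gt0 2 h0)).
have r0 : r k @[k --> \oo] --> (0 : R).
  rewrite /r -[X in _ --> X](mulr0 (48 * T ^+ 2)); apply: cvgM; first exact: cvg_cst.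
  exact: cvg_harmonic.
have cbound : (c * (32 * h ^+ 2 + 4 * ((h ^+ 2) ^+ 2 + r k / (h ^+ 2) ^+ 2)) +
    (h ^+ 2 + r k / (h ^+ 2) ^+ 3)) @[k --> \oo] -->
    (c * (32 * h ^+ 2 + 4 * ((h ^+ 2) ^+ 2 + 0 / (h ^+ 2) ^+ 2)) +
    (h ^+ 2 + 0 / (h ^+ 2) ^+ 3)).
  have rc (z : R) : r k * z @[k --> \oo] --> 0 * z by apply: cvgM => //; exact: cvg_cst.
  apply: (@cvgD _ R^o); last by apply: (@cvgD _ R^o); [exact: cvg_cst|exact: rc].
  apply: cvgM; first exact: cvg_cst.
  apply: (@cvgD _ R^o); first exact: cvg_cst.
  apply: cvgM; first exact: cvg_cst.
  by apply: (@cvgD _ R^o); [exact: cvg_cst|exact: rc].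
move: cbound; rewrite !mul0r !addr0 -[in X in _ --> X]exprM => cbound.
apply: (ler_cvg_to (cvg_norm cF) cbound).
by apply: nearW => k; exact: bound.
Qed.

End exit_value.

(** * Integration over the starting point *)

Section cells.
Context {R : realType}.
Implicit Types x h T : R.

Lemma brownian_densityE T x : 0 < T ->
  brownian_density T x = normal_pdf 0 (Num.sqrt T) x.
Proof.
move=> T0; have s0 : Num.sqrt T != 0 by rewrite gt_eqF// sqrtr_gt0.
rewrite normal_pdfE// /brownian_density /normal_peak /normal_fun subr0.
rewrite sqr_sqrtr; last exact: ltW.
have -> : T * pi *+ 2 = 2 * pi * T by ring.
by have -> : T *+ 2 = 2 * T by ring.
Qed.

Definition lattice h : set R := [set x | exists k : int, x = k%:~R * h].

Lemma lattice_countable h : countable (lattice h).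
Proof.
have -> : lattice h = range (fun k : int => k%:~R * h).
  by apply/seteqP; split => x [k]; [move=> ->; exists k|move=> _ <-; exists k].
by apply: (sub_countable (card_image_le _ _)); exact: countableP.
Qed.

Lemma floor_cell h x : 0 < h -> ~ lattice h x ->
  (Num.floor (x / h))%:~R * h < x < (Num.floor (x / h) + 1)%:~R * h.
Proof.
move=> h0 xN; set k := Num.floor (x / h).
have := floor_itv (x / h); rewrite -/k => /andP[k1 k2].
rewrite -[in X in _ && X](divfK (lt0r_neq0 h0) x) ltr_pM2r// k2 andbT.
rewrite lt_neqAle -ler_pdivlMr// k1 andbT.
by apply/eqP => E; apply: xN; exists k.
Qed.

(** The path moved by x ends at 0, which is a lattice point: it lies in no open
    cell, so that the bridge has to leave the cell of x. *)
Lemma zero_notin_cell h (k : int) : 0 < h -> ~~ (k%:~R * h < 0 < (k + 1)%:~R * h).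
Proof.
move=> h0; rewrite pmulr_llt0// pmulr_lgt0// ltrz0 ltr0z.
by apply/negP => /andP[k0 k1]; move: k0; rewrite ltNge -ltzD1 k1.
Qed.

(** The pointwise bound in terms of T and x only, using h <= sqrt T and
    |x| <= 1 + x^2. *)
Lemma cell_exit_bound_le (T h x : R) (q : nat) : 0 < T -> 0 < h -> h ^+ 2 <= T ->
  q%:R <= 32 * x ^+ 2 / T + 2 ->
  ((2 * h + 2 * `|x|) / T + 2 * h * q%:R / T) * (32 * h ^+ 2 + 4 * h ^+ 4) + h ^+ 2 <=
  (((6 * Num.sqrt T + 2) / T * (32 + 4 * T) + 1) +
   ((2 + 64 * Num.sqrt T / T) / T * (32 + 4 * T)) * x ^+ 2) * h ^+ 2.
Proof.
move=> T0 h0 hT qx.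
have hs : h <= Num.sqrt T by rewrite -(ger0_norm (ltW h0)) -sqrtr_sqr ler_wsqrtr.
set s := Num.sqrt T in hs *.
have x2 : `|x| <= 1 + x ^+ 2.
  rewrite -(real_normK (num_real x)).
  by have := sqr_ge0 (`|x| - 1); have := normr_ge0 x; nra.
have -> : 32 * h ^+ 2 + 4 * h ^+ 4 = (32 + 4 * h ^+ 2) * h ^+ 2 by ring.
rewrite mulrA -[X in _ + X <= _]mul1r -mulrDl ler_pM2r ?exprn_gt0//.
have -> : (6 * s + 2) / T * (32 + 4 * T) + 1 +
    (2 + 64 * s / T) / T * (32 + 4 * T) * x ^+ 2 =
    ((6 * s + 2) / T + (2 + 64 * s / T) / T * x ^+ 2) * (32 + 4 * T) + 1 by ring.
rewrite lerD2r; apply: ler_pM.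
- apply: addr_ge0; apply: divr_ge0; try exact: ltW.
    by apply: addr_ge0 => //; apply: mulr_ge0 => //; exact: ltW.
  by apply: mulr_ge0 => //; apply: mulr_ge0 => //; exact: ltW.
- by have := sqr_ge0 h; lra.
- rewrite -mulrDl (_ : (6 * s + 2) / T + _ = ((6 * s + 2) + (2 + 64 * s / T) * x ^+ 2) / T).
    rewrite ler_pM2r ?invr_gt0//.
    have s0 : 0 <= s by exact: sqrtr_ge0.
    have h1 : h * q%:R <= s * (32 * x ^+ 2 / T + 2) by apply: ler_pM => //; exact: ltW.
    have -> : 6 * s + 2 + (2 + 64 * s / T) * x ^+ 2 =
      6 * s + 2 + 2 * x ^+ 2 + 2 * (s * (32 * x ^+ 2 / T)) by ring.
    have -> : 2 * h * q%:R = 2 * (h * q%:R) by ring.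
    by move: h1; rewrite mulrDr; lra.
  by ring.
- by lra.
Qed.

End cells.

Theorem corollary3p3 (R : realType) (T : R) (hT : 0 < T) :
  exists C : R, 0 < C /\
    forall (d : measure_display) (Omega : R -> measurableType d)
      (P : forall y : R, probability (Omega y) R)
      (B : forall y : R, R -> {RV (P y) >-> R}),
      (forall y : R, brownian_bridge T y (B y)) ->
      forall n : nat, (0 < n)%N ->
        let h : R := Num.sqrt (T / n%:R) in
        (\int[lebesgue_measure]_x
           (`| 'E_(P (- x)%R)
                 [fun w => B (- x)%R
                    (cell_exit_time T h x (fun t => B (- x)%R t w)) w] |
            * (brownian_density T x)%:E)
         <= (C * h ^+ 2)%:E)%E.
Proof.
pose s := Num.sqrt T.
have s0 : 0 < s by rewrite sqrtr_gt0.
pose D0 := (6 * s + 2) / T * (32 + 4 * T) + 1.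
pose D1 := (2 + 64 * s / T) / T * (32 + 4 * T).
have D00 : 0 < D0.
  apply: addr_gt0 => //; apply: mulr_gt0; last by lra.
  by apply: divr_gt0 => //; lra.
have D10 : 0 < D1.
  apply: mulr_gt0; last by lra.
  by apply: divr_gt0 => //; apply: addr_gt0 => //; apply: divr_gt0 => //; lra.
(* The normal density has mass 1 and second moment T. *)
exists (D0 + D1 * T); split; first by apply: addr_gt0 => //; exact: mulr_gt0.
move=> d Omega P B bB n n0; cbv zeta; set h := Num.sqrt (T / n%:R).
have nR : 0 < n%:R :> R by rewrite ltr0n.
have h0 : 0 < h by rewrite sqrtr_gt0 divr_gt0.
have h2T : h ^+ 2 <= T.
  rewrite sqr_sqrtr; last by apply: divr_ge0; exact: ltW.
  by rewrite ler_pdivrMr// ler_peMr ?ler1n//; exact: ltW.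
pose phi := normal_pdf 0 s.
have phi0 x : 0 <= phi x by exact: normal_pdf_ge0.
pose g x := h ^+ 2 * (D0 * phi x + D1 * ((x - 0) ^+ 2 * phi x)).
have g0 x : 0 <= g x.
  apply: mulr_ge0; first exact: sqr_ge0.
  apply: addr_ge0; apply: mulr_ge0; try exact: ltW; first exact: phi0.
  by apply: mulr_ge0; [exact: sqr_ge0|exact: phi0].
have sn0 : s != 0 by rewrite gt_eqF.
have L0 : lebesgue_measure.-integrable setT (EFin \o phi).
  exact: integrable_normal_pdf.
have L2 := @integrable_exprn_normal_pdf R 0 s 2 sn0.
have LD0 := L1_Zl D0 L0; have LD1 := L1_Zl D1 L2.
have LD := L1_D LD0 LD1.
have Lg : lebesgue_measure.-integrable setT (EFin \o g) := L1_Zl (h ^+ 2) LD.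
have Ig : \int[lebesgue_measure]_x g x = (D0 + D1 * T) * h ^+ 2.
  rewrite (RintegralZl (h ^+ 2) measurableT LD) (RintegralD measurableT LD0 LD1).
  rewrite (RintegralZl D0 measurableT L0) (RintegralZl D1 measurableT L2).
  rewrite normal_moment0 normal_moment2// (sqr_sqrtr (ltW hT)).
  by ring.
have -> : ((D0 + D1 * T) * h ^+ 2)%:E = (\int[lebesgue_measure]_x (g x)%:E)%E.
  by rewrite -Ig /Rintegral fineK//; exact: integrable_fin_num.
apply: (@ge0_le_integral_off_null _ _ R lebesgue_measure (lattice h)).
- exact/countable_measurable/lattice_countable.
- exact/countable_lebesgue_measure0/lattice_countable.
- move=> x; rewrite brownian_densityE//; apply: mule_ge0; first exact: abse_ge0.
  by rewrite lee_fin.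
- by move=> x; rewrite lee_fin.
- exact: (measurable_int lebesgue_measure Lg).
move=> x xN; rewrite brownian_densityE//.
pose k := Num.floor (x / h).
have /andP[k1 k2] := floor_cell h0 xN.
(* The cut-off time T / q shrinks like 1 / x^2, as [path_square] requires. *)
pose q := (Num.truncn (32 * x ^+ 2 / T)).+2.
have lo0 : k%:~R * h - x < 0 by rewrite subr_lt0.
have up0 : 0 < (k + 1)%:~R * h - x by rewrite subr_gt0.
have ye : ~~ (k%:~R * h - x < - x < (k + 1)%:~R * h - x).
  by rewrite gtrDr ltrDr; exact: zero_notin_cell.
have u0 : 0 <= 32 * x ^+ 2 / T.
  by apply: divr_ge0; [rewrite mulr_ge0// sqr_ge0|exact: ltW].
have qy : 32 * (- x) ^+ 2 / T <= q%:R.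
  by rewrite sqrrN ltW// (lt_le_trans (truncnS_gt _))// ler_nat.
have qx : q%:R <= 32 * x ^+ 2 / T + 2.
  by rewrite /q -addn2 natrD lerD2r truncn_le.
have := exit_mean_bound hT (bB (- x)) lo0 up0 ye (isT : 2 <= q)%N qy.
have -> : (k + 1)%:~R * h - x - (k%:~R * h - x) = h.
  by rewrite intrD; ring.
rewrite normrN => H.
have {}H : (`| 'E_(P (- x)%R) [fun w => B (- x)%R
    (cell_exit_time T h x (fun t => B (- x)%R t w)) w] | <=
    ((D0 + D1 * x ^+ 2) * h ^+ 2)%:E)%E.
  apply: le_trans H _; rewrite lee_fin.
  exact: cell_exit_bound_le.
apply: (@le_trans _ _ (((D0 + D1 * x ^+ 2) * h ^+ 2)%:E * (phi x)%:E)%E).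
  by apply: lee_wpmul2r; rewrite ?lee_fin.
by rewrite -EFinM lee_fin /g subr0; apply: ler_eq_imp; ring.
Qed.
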